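(* Let $k\ge 3$ and $t\ge 3$ be integers, let $P:\{0,1\}^k\to\{0,1\}$ be a predicate, and suppose there is a $(t-1)$-wise uniform probability distribution $\nu$ on $\{0,1\}^k$ with $\mathbb{E}_{\nu}[P]=1$ (i.e. $\nu$ is supported on satisfying assignments of $P$). Let $\Delta$ be a constant and consider a random instance of $\mathrm{CSP}(P^{\pm})$ with $n$ variables and $m=\Delta n$ constraints. Then with high probability (as $n\to\infty$) there is an SOS pseudoexpectation $\widetilde{\mathbb{E}}$ of degree $\Omega\!\left(\frac{n}{\Delta^{2/(t-2)}\log\Delta}\right)$ which satisfies every constraint of the instance as an identity and, in addition, satisfies with pseudovariance zero the global bisection constraint $\sum_{i=1}^n x_i=\frac n2$ (for $n$ even). More generally, for any integer $B\in[\frac n2-O(\sqrt n),\frac n2+O(\sqrt n)]$, the pseudoexpectation can be chosen to also satisfy with pseudovariance zero the global Hamming weight constraint $\sum_{i=1}^n x_i=B$.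
   Context: A distribution on $\{0,1\}^N$ (or $\{\pm1\}^N$) is $s$-wise uniform if its marginal on every set of $s$ coordinates is uniform. $\mathrm{CSP}(P^{\pm})$: each constraint applies $P$ to $k$ literals (variables or their negations) on $k$ distinct variables; in a random instance, each of the $m$ constraints independently gets a uniformly random ordered $k$-tuple of distinct variables and a uniformly random negation pattern. A degree-$d$ pseudoexpectation over $\{0,1\}$-valued indeterminates $X_1,\dots,X_n$ is a linear functional $\widetilde{\mathbb{E}}$ on real polynomials of degree at most $d$ with $\widetilde{\mathbb{E}}[Q]=\widetilde{\mathbb{E}}[\mathrm{multilin}(Q)]$ (reduction modulo $X_i^2=X_i$), $\widetilde{\mathbb{E}}[1]=1$, and $\widetilde{\mathbb{E}}[Q^2]\ge 0$ whenever $\deg Q\le d/2$. It satisfies an identity $Q=b$ (as an identity) if $\widetilde{\mathbb{E}}[(Q-b)R]=0$ for all $R$ with $\deg R\le d-\deg Q$; it satisfies $Q=b$ with pseudovariance zero if $\widetilde{\mathbb{E}}[Q]=b$ and $\widetilde{\mathbb{E}}[Q^2]=b^2$. A constraint $P(\ell_1,\dots,\ell_k)=1$ is satisfied as an identity when the arithmetized polynomial identity $P(\ell_1,\dots,\ell_k)=1$ is satisfied.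
   Formalization: The degree bound is stated with Δ replaced by max(2, Δ), since log Δ is zero or negative for Δ ≤ 1 and the bound fails with a uniform constant as Δ → 1; m = Δn is rounded down to an integer. *)

(* Defs.v *)
From HB Require Import structures.
From mathcomp Require Import all_boot all_order all_algebra.
From mathcomp Require Import mpoly.
From mathcomp Require Import boolp reals exp.

Set Implicit Arguments.
Unset Strict Implicit.
Unset Printing Implicit Defensive.

Import Order.TTheory GRing.Theory Num.Theory.

Local Open Scope ring_scope.

(* [true] and [false] stand for the bits 1 and 0 throughout. *)
Definition is_distribution (R : realType) (T : finType) (nu : T -> R) : Prop :=
  (forall x, 0 <= nu x) /\ \sum_x nu x = 1.

(* For [s <= k] the condition on the sets of size exactly [s] implies the one
   on smaller sets; stating it for size at most [s] keeps it from being vacuous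
   when [s > k]. *)
Definition wise_uniform (R : realType) (k s : nat)
    (nu : {ffun 'I_k -> bool} -> R) : Prop :=
  forall (S : {set 'I_k}) (a : {ffun 'I_k -> bool}), (#|S| <= s)%N ->
    \sum_(x : {ffun 'I_k -> bool} | [forall i in S, x i == a i]) nu x =
      2 ^- #|S|.

(* A scope (an ordered tuple of distinct variables) and a negation pattern
   ([true] = negated). *)
Definition scope (n k : nat) := {v : {ffun 'I_k -> 'I_n} | injectiveb v}.
Definition constraint (n k : nat) := (scope n k * {ffun 'I_k -> bool})%type.
Definition instance (n k m : nat) := {ffun 'I_m -> constraint n k}.

(* Independent uniform constraints amount to the uniform distribution on the
   product type [instance n k m]. *)
Definition prob (R : realType) (T : finType) (A : T -> Prop) : R :=
  #|[pred x : T | `[< A x >]]|%:R / #|T|%:R.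

Section Polynomials.

Variables (R : realType) (n : nat).

Implicit Types (Q p q : {mpoly R[n]}) (Et : {mpoly R[n]} -> R) (d : nat).

(* The zero polynomial gets degree 0. *)
Definition deg Q : nat := (msize Q).-1.

Definition multilin Q : {mpoly R[n]} :=
  \sum_(mo <- msupp Q) Q@_mo *: 'X_[ [multinom (0 < mo i : nat)%N | i < n] ].

(* The functional is only meaningful in degree at most [d]: its values on
   polynomials of larger degree are unconstrained. *)
Definition is_pseudoexpectation d Et : Prop :=
  [/\ forall (a : R) p q, (deg p <= d)%N -> (deg q <= d)%N ->
        Et (a *: p + q) = a * Et p + Et q,
      forall Q, (deg Q <= d)%N -> Et Q = Et (multilin Q),
      Et 1 = 1
    & forall Q, (2 * deg Q <= d)%N -> 0 <= Et (Q ^+ 2)].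

(* The degree condition is [deg T <= d - deg Q] without truncated subtraction. *)
Definition satisfies_identity d Et Q (b : R) : Prop :=
  forall T : {mpoly R[n]}, (deg Q + deg T <= d)%N ->
    Et ((Q - b%:MP) * T) = 0.

Definition satisfies_pseudovar0 Et Q (b : R) : Prop :=
  Et Q = b /\ Et (Q ^+ 2) = b ^+ 2.

Definition literal (k : nat) (C : constraint n k) (j : 'I_k) : {mpoly R[n]} :=
  if C.2 j then 1 - 'X_(sval C.1 j) else 'X_(sval C.1 j).

(* The multilinear polynomial interpolating [P], evaluated at the literals. *)
Definition arith (k : nat) (P : {ffun 'I_k -> bool} -> bool)
    (C : constraint n k) : {mpoly R[n]} :=
  \sum_(a : {ffun 'I_k -> bool} | P a)
    \prod_(j < k) (if a j then literal C j else 1 - literal C j).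

Definition satisfies_instance (k m : nat) (P : {ffun 'I_k -> bool} -> bool)
    (I : instance n k m) d Et : Prop :=
  forall c : 'I_m, satisfies_identity d Et (arith P (I c)) 1.

Definition hamming_weight : {mpoly R[n]} := \sum_(i < n) 'X_i.

End Polynomials.

(* [n / (Delta ^ (2 / (t - 2)) * ln Delta)] as soon as [Delta >= 2]. The maximum
   extends this to small [Delta], where the logarithm would vanish or become
   negative, by the value at 2. *)
Definition degree_rate (R : realType) (t : nat) (Delta : R) (n : nat) : R :=
  let D := Num.max 2 Delta in
  n%:R / (powR D (2 / (t%:R - 2)) * ln D).

(* Main.v *)
Require Import Defs.
From HB Require Import structures.
From mathcomp Require Import all_boot all_order all_algebra.
From mathcomp Require Import mpoly.
From mathcomp Require Import boolp reals sequences exp.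
From mathcomp Require Import zify ring lra.

Import Order.TTheory GRing.Theory Num.Theory.

Local Open Scope ring_scope.

(** Attach to every constraint [f] the density [D f = 2 ^ k * nu(literals)] with
    respect to the uniform distribution.  Since [nu] is [(t - 1)]-wise uniform,
    [D f - 1] only has characters of size at least [t].  If every family [F] of
    at most [M] constraints touches at least [(k - t / 2 + delta) #|F|]
    variables, then every set [A] of variables has a closure: a maximal family
    [F] with [2 #|A :|: vars F| - (2 k - t) #|F| <= 2 #|A|], which has at most
    [#|A| / delta] members.  Any further constraints are attached to the outside
    of [N = A :|: vars F] by strictly more variables than to [N].  Hence the
    moment of a character [chi U] under the density [prod_(f in F) D f] is the
    same for all closed families seeing [U], and these moments define the
    pseudoexpectation.

    For positivity, order the sets of variables by cardinality.  Let [y_S] be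
    [chi S] minus its projection, for the genuine distribution of the closure of
    [S], onto the preceding characters living on that closure.  A preceding
    [chi T] that does not live there is seen from the closure as a combination
    of smaller characters that do, by the attachment property, so [y_S] is
    orthogonal to all characters preceding [S].  Therefore the moment matrix is
    triangularly congruent to a diagonal matrix with entries [E[y_S ^ 2] >= 0].

    For the Hamming weight, pair the variable [i] with [n - 1 - i] and substitute
    opposite literals.  The few variables whose partner occurs in a common
    constraint are compensated by variables occurring in no constraint, and
    the remaining ones among the latter are set to constants, which makes the
    weight identically equal to [B].  With high probability the instance with
    paired variables identified expands (first moment, [delta ~ 1 / ln Delta]),
    few constraints contain a pair (Markov), and linearly many variables are
    isolated together with their partner (Chebyshev). *)

(** * Fourier analysis on the cube *)

Section Cube.

Set Implicit Arguments.
Unset Strict Implicit.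
Unset Printing Implicit Defensive.

Variables (R : realFieldType) (V : finType).
Local Notation cube := {ffun V -> bool}.
Implicit Types (X Y N : {set V}) (y : cube) (g h : cube -> R).

Definition symdiff X Y := [set v | (v \in X) (+) (v \in Y)].

Definition chi X y : R := \prod_(v in X) (-1) ^+ y v.

Definition Ex g : R := (\sum_y g y) / 2 ^+ #|V|.

Definition flip v y : cube := [ffun w => (w == v) (+) y w].

Lemma flipK v : involutive (flip v).
Proof. by move=> y; apply/ffunP=> w; rewrite !ffunE addbA addbb. Qed.

Lemma symdiff0 X : symdiff set0 X = X.
Proof. by apply/setP=> v; rewrite !inE. Qed.

Lemma symdiffC X Y : symdiff X Y = symdiff Y X.
Proof. by apply/setP=> v; rewrite !inE addbC. Qed.


Lemma symdiffK X Y : symdiff X (symdiff X Y) = Y.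
Proof. by apply/setP=> v; rewrite !inE addbA addbb. Qed.

Lemma chi0 y : chi set0 y = 1.
Proof. by rewrite /chi big_set0. Qed.

Lemma chi1 v y : chi [set v] y = (-1) ^+ y v.
Proof. by rewrite /chi big_set1. Qed.

Lemma chiM X Y y : chi X y * chi Y y = chi (symdiff X Y) y.
Proof.
rewrite /chi (big_mkcond (mem X)) (big_mkcond (mem Y)) (big_mkcond (mem (symdiff X Y))) /=.
rewrite -big_split /=; apply: eq_bigr => v _; rewrite inE.
by case: (v \in X) (v \in Y) => [] [] /=; case: (y v); rewrite ?expr1 ?expr0 ?mulr1 ?mul1r ?mulrNN ?mulr1.
Qed.

Lemma chi_sqr X y : chi X y * chi X y = 1.
Proof.
rewrite chiM (_ : symdiff X X = set0) ?chi0 //.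
by apply/setP=> v; rewrite !inE addbb.
Qed.

Lemma chi_flip v X y : chi X (flip v y) = (-1) ^+ (v \in X) * chi X y.
Proof.
have -> : (-1) ^+ (v \in X) = \prod_(w in X) (-1) ^+ (w == v) :> R.
  case: (boolP (v \in X)) => vX; last first.
    by rewrite big1 // => w wX; case: eqP => // e; rewrite -e wX in vX.
  rewrite (bigD1 v) //= eqxx big1 ?mulr1 // => w /andP[_ /negPf ->].
  by rewrite expr0.
rewrite /chi -big_split /=; apply: eq_bigr => w _; rewrite ffunE.
by case: eqP; case: (y w); rewrite /= ?expr0 ?expr1 ?mulrNN ?mulr1 ?mul1r.
Qed.

Lemma Ex_ext g h : g =1 h -> Ex g = Ex h.
Proof. by move=> e; rewrite /Ex (eq_bigr h). Qed.

Lemma ExD g h : Ex (fun y => g y + h y) = Ex g + Ex h.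
Proof. by rewrite /Ex big_split /= mulrDl. Qed.

Lemma ExZ a g : Ex (fun y => a * g y) = a * Ex g.
Proof. by rewrite /Ex -mulr_sumr mulrA. Qed.

Lemma Ex_sum (I : finType) (F : I -> cube -> R) :
  Ex (fun y => \sum_i F i y) = \sum_i Ex (F i).
Proof. by rewrite /Ex exchange_big mulr_suml. Qed.

Lemma Ex1 : Ex (fun=> 1) = 1.
Proof.
rewrite /Ex big_const iter_addr_0 card_ffun card_bool.
by rewrite natrX divff // expf_neq0 // pnatr_eq0.
Qed.

Lemma Ex_flip v g : (forall y, g (flip v y) = - g y) -> Ex g = 0.
Proof.
move=> hg; rewrite /Ex.
have e : \sum_y g y = - \sum_y g y.
  by rewrite [LHS](reindex_inj (inv_inj (flipK v))) -sumrN /=; apply: eq_bigr.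
have -> : \sum_y g y = 0 by lra.
by rewrite mul0r.
Qed.

Lemma Ex_chi X : X != set0 -> Ex (chi X) = 0.
Proof.
case/set0Pn=> v vX; apply: (@Ex_flip v) => y.
by rewrite chi_flip vX expr1 mulN1r.
Qed.

Lemma Ex_chiM X Y : Ex (fun y => chi X y * chi Y y) = (X == Y)%:R.
Proof.
case: eqP => [->|/eqP ne].
  by rewrite (Ex_ext (chi_sqr Y)) Ex1.
rewrite (Ex_ext (chiM X Y)) Ex_chi //; apply: contraNneq ne => e.
by rewrite -[Y](symdiffK X) e; apply/eqP/setP=> v; rewrite !inE addbF.
Qed.

(** The Fourier support of [g] satisfies [C]. Size bounds, inclusion in a set and attachment
    conditions as [C] express degree, dependence on few coordinates and the effect of further
    constraints. *)
Definition in_span (C : {set V} -> Prop) g :=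
  exists2 r : {set V} -> R, (forall y, g y = \sum_X r X * chi X y) &
    forall X, r X != 0 -> C X.

Lemma span_ext C g h : g =1 h -> in_span C g -> in_span C h.
Proof. by move=> e [r hr rC]; exists r => // y; rewrite -e. Qed.

Lemma spanW (C C' : {set V} -> Prop) g :
  (forall X, C X -> C' X) -> in_span C g -> in_span C' g.
Proof. by move=> cc [r hr rC]; exists r => // X /rC /cc. Qed.

Lemma span_chi (C : {set V} -> Prop) X : C X -> in_span C (chi X).
Proof.
move=> cX; exists (fun Y => (Y == X)%:R) => [y|Y].
  rewrite (bigD1 X) //= eqxx mul1r big1 ?addr0 // => Y /negPf ->.
  by rewrite mul0r.
by case: (eqVneq Y X) => [->|_] //; rewrite eqxx.
Qed.

Lemma span0 C : in_span C (fun=> 0).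
Proof.
exists (fun=> 0) => [y|X]; last by rewrite eqxx.
by rewrite big1 // => X _; rewrite mul0r.
Qed.

Lemma spanZD C a g h : in_span C g -> in_span C h ->
  in_span C (fun y => a * g y + h y).
Proof.
move=> [r hr rC] [s hs sC]; exists (fun X => a * r X + s X) => [y|X].
  rewrite hr hs mulr_sumr -big_split /=; apply: eq_bigr => X _.
  by rewrite mulrDl mulrA.
case: (eqVneq (r X) 0) => [->|/rC //]; rewrite mulr0 add0r; exact: sC.
Qed.

Lemma spanZ C a g : in_span C g -> in_span C (fun y => a * g y).
Proof.
move=> hg; apply: span_ext (spanZD a hg (span0 C)) => y.
by rewrite addr0.
Qed.

Lemma spanD C g h : in_span C g -> in_span C h -> in_span C (fun y => g y + h y).
Proof.
move=> hg hh; apply: span_ext (spanZD 1 hg hh) => y.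
by rewrite mul1r.
Qed.

Lemma span_sum C (I : eqType) (s : seq I) (F : I -> cube -> R) :
  (forall i, i \in s -> in_span C (F i)) -> in_span C (fun y => \sum_(i <- s) F i y).
Proof.
elim: s => [|i s IH] hF.
  by apply: span_ext (span0 C) => y; rewrite big_nil.
apply: (span_ext (g := fun y => F i y + \sum_(j <- s) F j y)) => [y|].
  by rewrite big_cons.
by apply: spanD; [apply: hF; rewrite mem_head|apply: IH => j js; apply: hF; rewrite inE js orbT].
Qed.

Lemma spanM (C1 C2 C : {set V} -> Prop) g h :
  (forall X Y, C1 X -> C2 Y -> C (symdiff X Y)) ->
  in_span C1 g -> in_span C2 h -> in_span C (fun y => g y * h y).
Proof.
move=> cc [r hr rC] [s hs sC].
apply: (span_ext (g := fun y => \sum_X r X * \sum_Y s Y * chi (symdiff X Y) y)) => [y|].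
  rewrite hr hs mulr_suml; apply: eq_bigr => X _.
  rewrite -mulrA; congr (_ * _); rewrite mulr_sumr; apply: eq_bigr => Y _.
  by rewrite mulrCA chiM.
apply: span_sum => X _.
case: (eqVneq (r X) 0) => [->|/rC cX].
  by apply: span_ext (span0 C) => y; rewrite mul0r.
apply: spanZ; apply: span_sum => Y _.
case: (eqVneq (s Y) 0) => [->|/sC cY].
  by apply: span_ext (span0 C) => y; rewrite mul0r.
by apply: spanZ; apply: span_chi; apply: cc.
Qed.

(** The indicator of a point is a product of one factor per coordinate, each a combination of
    [chi set0] and a singleton character; indicators span all functions. *)
Lemma span_all g : in_span (fun=> True) g.
Proof.
pose ind (z y : cube) : R := \prod_v ((1 + (-1) ^+ (z v (+) y v)) / 2).
have indE z y : ind z y = (z == y)%:R.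
  rewrite /ind; case: eqP => [->|ne].
    by rewrite big1 // => v _; rewrite addbb expr0; lra.
  have [v hv] : exists v, z v != y v.
    apply/existsP; rewrite -negb_forall; apply/negP=> /forallP h.
    by apply: ne; apply/ffunP=> v; apply/eqP.
  rewrite (bigD1 v) //=; move: hv; case: (z v) (y v) => [] [] //= _;
  by rewrite expr1 subrr !mul0r.
apply: (span_ext (g := fun y => \sum_z g z * ind z y)) => [y|].
  rewrite (bigD1 y) //= indE eqxx mulr1 big1 ?addr0 // => z /negPf h.
  by rewrite indE h mulr0.
apply: span_sum => z _; apply: spanZ; rewrite /ind.
elim: (index_enum V) => [|v s IH].
  by apply: span_ext (span_chi (X := set0) I) => y; rewrite chi0 big_nil.
apply: (span_ext (g := fun y => (2^-1 * chi set0 y + (-1) ^+ z v / 2 * chi [set v] y) *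
    \prod_(i <- s) ((1 + (-1) ^+ (z i (+) y i)) / 2))) => [y|].
  rewrite big_cons chi0 chi1; congr (_ * _).
  by rewrite signr_addb; ring.
apply: (spanM (C1 := fun=> True) (C2 := fun=> True)) IH => //.
by apply: spanD; apply: spanZ; apply: span_chi.
Qed.

Lemma span_flip N v g y : in_span (fun X => X \subset N) g -> v \notin N ->
  g (flip v y) = g y.
Proof.
move=> [r hr rC] vN; rewrite !hr; apply: eq_bigr => X _.
case: (eqVneq (r X) 0) => [->|/rC XN]; first by rewrite !mul0r.
by rewrite chi_flip (contraNF (subsetP XN v) vN) mul1r.
Qed.

End Cube.

(** * Closures and the pseudo-moments *)

Section Closure.

Set Implicit Arguments.
Unset Strict Implicit.
Unset Printing Implicit Defensive.

Variables (R : realFieldType) (V J : finType) (k t : nat).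
Local Notation cube := {ffun V -> bool}.
Variables (vars : J -> {set V}) (D : J -> cube -> R).
Hypothesis card_vars : forall f, (#|vars f| <= k)%N.
Hypothesis D_ge0 : forall f y, 0 <= D f y.
Hypothesis D_span : forall f,
  in_span (fun X => X \subset vars f /\ (t <= #|X|)%N) (fun y => D f y - 1).
Variables (M : nat) (delta : R).
Hypothesis delta_gt0 : 0 < delta.
Hypothesis expansion : forall F : {set J}, (#|F| <= M)%N ->
  (2 * k%:R + 2 * delta) * #|F|%:R <=
    2 * #|\bigcup_(f in F) vars f|%:R + t%:R * #|F|%:R.

Implicit Types (A N Q S T U X : {set V}) (F G : {set J}) (y : cube) (g h : cube -> R).

(** * Families of constraints, their densities and closed families *)

Definition vs F := \bigcup_(f in F) vars f.
Definition dens F y : R := \prod_(f in F) D f y.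
Definition EF F g := Ex (fun y => g y * dens F y).

Lemma vsU F G : vs (F :|: G) = vs F :|: vs G.
Proof. by rewrite /vs bigcup_setU. Qed.

Lemma vs_sub F f : f \in F -> vars f \subset vs F.
Proof. by move=> fF; rewrite /vs; apply: bigcup_sup. Qed.

Lemma vsS F G : F \subset G -> vs F \subset vs G.
Proof. by move=> /setUidPr <-; rewrite vsU subsetUl. Qed.

Lemma dens_ge0 F y : 0 <= dens F y.
Proof. by apply: prodr_ge0 => f _. Qed.

Lemma densU F G y : [disjoint F & G] -> dens (F :|: G) y = dens F y * dens G y.
Proof.
move=> d; rewrite /dens -bigU //=; apply: eq_bigl => f.
by rewrite !inE.
Qed.

Lemma dens_flip N F v y : vs F \subset N -> v \notin N ->
  dens F (flip v y) = dens F y.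
Proof.
move=> FN vN; apply: eq_bigr => f fF.
have vf : v \notin vars f.
  by apply: contraNN vN => /(subsetP (vs_sub fF)) /(subsetP FN).
have := @span_flip R V (vars f) v (fun y => D f y - 1) y _ vf.
by move=> e; apply: (addIr (-1)); apply: e; apply: spanW (D_span f) => X [].
Qed.

(* [2 #|A :|: vs F| - (2 k - t) #|F| <= 2 #|A|], without truncated subtraction. *)
Definition potential A F := (2 * #|A :|: vs F| + t * #|F| <= 2 * #|A| + 2 * k * #|F|)%N.

(** Maximality ranges only over families of at most [M] members, where expansion is known. Families
    to be compared must therefore always be shown to stay within [M]. *)
Definition closed A F := [/\ potential A F, (#|F| <= M)%N &
  forall G, F \proper G -> (#|G| <= M)%N -> ~~ potential A G].

Lemma closed_exists A F : potential A F -> (#|F| <= M)%N ->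
  exists2 G : {set J}, F \subset G & closed A G.
Proof.
move=> pF cF; pose C (G : {set J}) := potential A G && (#|G| <= M)%N.
have [|G mG sG] := @maxset_exists _ C F; first by rewrite /C pF.
have /andP[pG cG] := maxsetp mG.
exists G => //; split=> // H sH cH; apply/negP=> pH.
move: (sH); rewrite (maxsetsup mG _ (proper_sub sH)) ?properxx //.
by rewrite /C pH.
Qed.

Lemma potential0 A : potential A set0.
Proof. by rewrite /potential /vs big_set0 setU0 cards0 !muln0. Qed.

(** The potential bounds [2 #|vs F| + t #|F|] above by [2 #|A| + 2 k #|F|], and expansion bounds it
    below by [(2 k + 2 delta) #|F|]. *)
Lemma closed_card A F : closed A F -> delta * #|F|%:R <= #|A|%:R.
Proof.
move=> [pF cF _]; have := expansion cF.
move: pF; rewrite /potential => pF.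
have le1 : (#|vs F| <= #|A :|: vs F|)%N by rewrite subset_leq_card // subsetUr.
have : (2 * #|vs F| + t * #|F| <= 2 * #|A| + 2 * k * #|F|)%N by lia.
rewrite -(ler_nat R) !natrD !natrM -/(vs F) => a b.
by lra.
Qed.

(** Invariant of a character [X] occurring in the product of the [D f - 1] over [G]: its surplus of
    variables outside [N] over those inside is at least [2 #|vs G :\: N| + t #|G| - 2 k #|G|], the
    change of the potential caused by adding [G]. *)
Definition attach N G X := [/\ X :\: N \subset vs G &
  (2 * #|vs G :\: N| + t * #|G| + #|X :&: N| <= #|X :\: N| + 2 * k * #|G|)%N].

(** Split [Q] into the parts [q1] inside [N], [q2] already touched by [G] and [q3] new. Then [f]
    brings at most [q3 + k - #|Q|] new variables and the surplus of [X] changes by at least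
    [q3 - q1 - q2], so the inequality survives because [t <= #|Q|]. *)
Lemma attach_step N G X f Q : f \notin G -> attach N G X ->
  Q \subset vars f -> (t <= #|Q|)%N -> attach N (f |: G) (symdiff X Q).
Proof.
move=> fG [sX iX] sQ tQ.
have vsE : vs (f |: G) = vars f :|: vs G by rewrite vsU /vs big_set1.
split.
  rewrite vsE; apply/subsetP => v; rewrite !inE => /andP[vN].
  case: (boolP (v \in Q)) => [vQ _|_]; first by rewrite (subsetP sQ).
  rewrite addbF => vX; apply/orP; right; apply: (subsetP sX).
  by rewrite !inE vN.
rewrite vsE cardsU1 fG.
set q1 := #|Q :&: N|; set q2 := #|Q :&: (vs G :\: N)|.
set q3 := #|Q :\: (N :|: vs G)|.
have cQ : (#|Q| = q1 + q2 + q3)%N.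
  rewrite /q1 /q2 /q3 -(cardsID N Q) -addnA; congr (_ + _)%N.
  rewrite -(cardsID (vs G) (Q :\: N)); congr (_ + _)%N; apply: eq_card => v;
  by rewrite !inE; case: (v \in N); case: (v \in vs G); case: (v \in Q).
have e1 : (#|(vars f :|: vs G) :\: N| = #|vs G :\: N| + #|vars f :\: (N :|: vs G)|)%N.
  rewrite -(cardsID (vs G) (_ :\: N)); congr (_ + _)%N; apply: eq_card => v;
  by rewrite !inE; case: (v \in N); case: (v \in vs G); case: (v \in vars f).
have e2 : (#|vars f :\: (N :|: vs G)| + #|Q| <= q3 + k)%N.
  have h1 : (#|vars f :\: (N :|: vs G)| <= q3 + #|vars f :\: Q|)%N.
    apply: leq_trans (leq_card_setU _ _).1; apply: subset_leq_card.
    apply/subsetP => v; rewrite !inE.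
    by case: (v \in N); case: (v \in vs G); case: (v \in vars f); case: (v \in Q).
  have h2 : (#|vars f :\: Q| + #|Q| <= k)%N.
    rewrite addnC -{1}(setIidPr sQ) -(setIC Q) ?(cardsID Q) //.
    by rewrite setIC cardsID; apply: card_vars.
  by move: h1 h2; lia.
have e3 : (#|symdiff X Q :&: N| <= #|X :&: N| + q1)%N.
  apply: leq_trans (leq_card_setU _ _).1; apply: subset_leq_card.
  apply/subsetP => v; rewrite !inE.
  by case: (v \in N); case: (v \in X); case: (v \in Q).
(* Outside [N], toggling [Q] deletes at most [q2] elements, while the [q3] new ones are disjoint
   from [X] and survive. *)
have e4 : (#|X :\: N| + q3 <= #|symdiff X Q :\: N| + q2)%N.
  have d : [disjoint X :\: N & Q :\: (N :|: vs G)].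
    rewrite -setI_eq0; apply/eqP/setP=> v; rewrite !inE.
    apply/negbTE/negP => /andP[/andP[vN vX]] /andP[].
    by rewrite (subsetP sX v) ?orbT // inE vN.
  have -> : (#|X :\: N| + q3 = #|(X :\: N) :|: (Q :\: (N :|: vs G))|)%N.
    by apply/esym/eqP; rewrite (leq_card_setU _ _).2.
  apply: leq_trans (leq_card_setU _ _).1; apply: subset_leq_card.
  apply/subsetP => v; have := subsetP sX v; rewrite !inE.
  by case: (v \in N); case: (v \in vs G); case: (v \in X); case: (v \in Q).
by rewrite /= e1 !mulnDr !muln1; move: iX cQ e2 e3 e4 tQ; lia.
Qed.

(** Expanding every factor as [1 + (D f - 1)] and removing the constant term leaves products over
    nonempty subfamilies [G']. *)
Lemma dens_span N G : in_span (fun X => exists G' : {set J},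
    [/\ G' \subset G, G' != set0 & attach N G' X]) (fun y => dens G y - 1).
Proof.
move: {2}(#|G|) (erefl #|G|) => c; elim: c G => [|c IH] G cG.
  apply: span_ext (span0 _ _) => y.
  by rewrite (cards0_eq cG) /dens big_set0 subrr.
have [f fG] : exists f, f \in G by apply/set0Pn; rewrite -card_gt0 cG.
have c1 : #|G :\ f| = c by move: (cardsD1 f G); rewrite fG cG => -[].
have fnG (G' : {set J}) : G' \subset G :\ f -> f \notin G'.
  by move=> s; apply/negP=> /(subsetP s); rewrite !inE eqxx.
have sG (G' : {set J}) : G' \subset G :\ f -> f |: G' \subset G.
  move=> s; rewrite subUset sub1set fG.
  exact: subset_trans s (subsetDl _ _).
have n0 (G' : {set J}) : f |: G' != set0.
  by apply/set0Pn; exists f; rewrite setU11.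
pose h1 y := (dens (G :\ f) y - 1) * (D f y - 1).
apply: (span_ext (g := fun y => h1 y + ((D f y - 1) + (dens (G :\ f) y - 1)))).
  move=> y; rewrite /h1 /(dens G) (big_setD1 f) //= -/(dens _ y); ring.
have IH' := IH _ c1.
apply: spanD; last apply: spanD.
- apply: (spanM _ IH' (D_span f)) => X Q [G' [s _ a]] [sQ tQ].
  exists (f |: G'); split=> //; first exact: sG.
  exact: attach_step (fnG _ s) a sQ tQ.
- apply: spanW (D_span f) => Q [sQ tQ].
  exists (f |: set0); split=> //; first by apply: sG; apply: sub0set.
  rewrite -[Q]symdiff0; apply: attach_step => //; first by rewrite inE.
  by split; rewrite ?set0D ?sub0set // /vs big_set0 set0D set0I !cards0 !muln0.
- apply: spanW IH' => X [G' [s nz a]]; exists G'; split=> //.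
  exact: subset_trans s (subsetDl _ _).
Qed.

(** By maximality [F :|: G'] violates the potential inequality that [F] satisfies. Subtracting the
    two makes the change in [attach] strictly positive, hence also the surplus outside. *)
Lemma closed_span A F G : closed A F -> [disjoint F & G] -> (#|F :|: G| <= M)%N ->
  in_span (fun X => (#|X :&: (A :|: vs F)| < #|X :\: (A :|: vs F)|)%N)
    (fun y => dens G y - 1).
Proof.
move=> [pF cF mF] dFG cFG.
apply: spanW (dens_span (A :|: vs F) G) => X [G' [sG nz [_ aX]]].
have dFG' : [disjoint F & G'] by apply: disjointWr sG dFG.
have cFG' : #|F :|: G'| = (#|F| + #|G'|)%N.
  by apply/eqP; rewrite (leq_card_setU _ _).2.
have prop : F \proper F :|: G'.
  rewrite properEcard subsetUl cFG' -[X in (X < _)%N]addn0 ltn_add2l card_gt0.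
  exact: nz.
have := mF _ prop (leq_trans (subset_leq_card (setUS F sG)) cFG).
rewrite /potential -ltnNge cFG' vsU setUA.
have -> : #|A :|: vs F :|: vs G'| = (#|A :|: vs F| + #|vs G' :\: (A :|: vs F)|)%N.
  rewrite -(cardsID (A :|: vs F) (_ :|: vs G')); congr (_ + _)%N; apply: eq_card => v;
  by rewrite !inE; case: (v \in A); case: (v \in vs F); case: (v \in vs G').
move: pF aX; rewrite /potential.
move: #|X :\: _| #|X :&: _| #|vs G' :\: _| => *; nia.
Qed.

(** * Expectations under the density of a family *)

Lemma EF_ext F g h : g =1 h -> EF F g = EF F h.
Proof. by move=> e; apply: Ex_ext => y; rewrite e. Qed.

Lemma EFZD F a g h : EF F (fun y => a * g y + h y) = a * EF F g + EF F h.
Proof.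
rewrite /EF -ExZ -ExD; apply: Ex_ext => y; ring.
Qed.

Lemma EF_sum F (I : finType) (r : I -> R) (g : I -> cube -> R) :
  EF F (fun y => \sum_i r i * g i y) = \sum_i r i * EF F (g i).
Proof.
rewrite /EF; under [RHS]eq_bigr => i _ do rewrite -ExZ.
rewrite -Ex_sum; apply: Ex_ext => y; rewrite mulr_suml.
by apply: eq_bigr => i _; rewrite mulrA.
Qed.

(** Flipping a variable of [T] outside [N] changes neither [h] nor the density but negates
    [chi T]. *)
Lemma EF_vanish A F N h T : vs F \subset N -> in_span (fun X => X \subset N) h ->
  ~~ (T \subset N) -> EF F (fun y => h y * chi R T y) = 0.
Proof.
move=> FN hN /subsetPn[v vT vN]; apply: (@Ex_flip _ _ v) => y.
rewrite (span_flip _ hN vN) (dens_flip _ FN vN) chi_flip vT expr1; ring.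
Qed.

(** The density of [F'] is that of [F] times [dens (F' :\: F)], which [closed_span] expands. The
    weight [h] is carried along for testing orthogonality in the positivity argument. *)
Lemma EF_extend A F F' h T : closed A F -> F \subset F' -> (#|F'| <= M)%N ->
  exists2 r : {set V} -> R,
    EF F' (fun y => h y * chi R T y) =
      EF F (fun y => h y * chi R T y) +
      \sum_X r X * EF F (fun y => h y * chi R (symdiff X T) y) &
    forall X, r X != 0 -> (#|X :&: (A :|: vs F)| < #|X :\: (A :|: vs F)|)%N.
Proof.
move=> cF sF cF'.
have FE : F :|: (F' :\: F) = F'.
  apply/setP=> f; rewrite !inE.
  by case: (boolP (f \in F)) => //= /(subsetP sF) ->.
have dF : [disjoint F & F' :\: F].
  rewrite -setI_eq0; apply/eqP/setP=> f; rewrite !inE.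
  by case: (f \in F).
have [|r rE rC] := @closed_span A F (F' :\: F) cF dF; first by rewrite FE.
exists r => //.
rewrite -EF_sum /EF -ExD; apply: Ex_ext => y.
rewrite -{1}FE densU //.
have -> : dens (F' :\: F) y = 1 + \sum_X r X * chi R X y by rewrite -rE; ring.
have -> : \sum_X r X * (h y * chi R (symdiff X T) y) =
   h y * chi R T y * \sum_X r X * chi R X y.
  by rewrite mulr_sumr; apply: eq_bigr => X _; rewrite -chiM; ring.
ring.
Qed.

(** Every correction character has a variable outside [A :|: vs F], which [U] cannot cancel, so all
    corrections vanish. *)
Lemma EF_closed A F F' U : closed A F -> F \subset F' -> (#|F'| <= M)%N ->
  U \subset A :|: vs F -> EF F' (chi R U) = EF F (chi R U).
Proof.
move=> cF sF cF' UN.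
have [r rE rC] := EF_extend (fun=> 1) U cF sF cF'.
have e G : EF G (chi R U) = EF G (fun y => 1 * chi R U y).
  by apply: EF_ext => y; rewrite mul1r.
rewrite !e rE big1 ?addr0 // => X _.
case: (eqVneq (r X) 0) => [->|/rC lt]; first by rewrite mul0r.
rewrite (@EF_vanish A _ (A :|: vs F)) ?mulr0 ?subsetUr //.
  apply: (span_ext (g := chi R set0)) => [y|]; first by rewrite chi0.
  by apply: span_chi; rewrite sub0set.
have /set0Pn[v] : X :\: (A :|: vs F) != set0 by rewrite -card_gt0; lia.
rewrite inE => /andP[vN vX]; apply/subsetPn; exists v => //.
by rewrite inE vX (contraNF (subsetP UN v) vN).
Qed.

(** * Pseudo-moments read off from closures *)

Variable L : nat.
(** By [closed_card], families closed for at most [L] variables have at most [M / 2] members, so the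
    union of two of them stays within [M]. *)
Hypothesis leLM : 2 * L%:R <= delta * M%:R.

Lemma closedU_card A F A' F' : (#|A| <= L)%N -> (#|A'| <= L)%N ->
  closed A F -> closed A' F' -> (#|F :|: F'| <= M)%N.
Proof.
move=> cA cA' /closed_card h /closed_card h'.
have : (#|F :|: F'| <= #|F| + #|F'|)%N by apply: (leq_card_setU _ _).1.
move=> le; apply: (leq_trans le); rewrite -(ler_nat R) natrD.
rewrite -(ler_pM2l delta_gt0).
move: cA cA' h h' leLM; rewrite -!(ler_nat R) mulrDr.
move: (delta * _) (delta * _) (delta * _) => x y z; lra.
Qed.

(** Both sides are compared with the common extension [F :|: F']. *)
Lemma closed_consistent A F A' F' U : (#|A| <= L)%N -> (#|A'| <= L)%N ->
  closed A F -> closed A' F' -> U \subset A :|: vs F -> U \subset A' :|: vs F' ->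
  EF F (chi R U) = EF F' (chi R U).
Proof.
move=> cA cA' cF cF' UA UA'.
have c := closedU_card cA cA' cF cF'.
by rewrite -(EF_closed cF _ c UA) ?subsetUl // (EF_closed cF' _ c UA') // subsetUr.
Qed.

Lemma closure_spec U : exists F, closed U F.
Proof.
have [|F _ cF] := @closed_exists U set0 (potential0 U); first by rewrite cards0.
by exists F.
Qed.

(** An arbitrary choice; by [closed_consistent] the moments of sets of at most [L] variables do not
    depend on it. *)
Definition closure U := sval (cid (closure_spec U)).


Lemma closureP U : closed U (closure U).
Proof. exact: svalP (cid (closure_spec U)). Qed.

Definition moment U : R := EF (closure U) (chi R U).

Lemma momentE A F U : (#|A| <= L)%N -> (#|U| <= L)%N -> closed A F ->
  U \subset A :|: vs F -> moment U = EF F (chi R U).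
Proof.
move=> cA cU cF UN.
exact: closed_consistent cU cA (closureP U) cF (subsetUl _ _) UN.
Qed.

Lemma moment0 : moment set0 = 1.
Proof.
have := closed_card (closureP set0); rewrite cards0 => h.
have : #|closure set0|%:R <= 0 :> R by rewrite -(pmulr_rle0 _ delta_gt0).
rewrite lern0 cards_eq0 /moment => /eqP ->.
rewrite /EF (@Ex_ext _ _ _ (fun=> 1)) ?Ex1 // => y.
by rewrite chi0 mul1r /dens big_set0.
Qed.

(** The density is nonnegative, so a null square forces [h] times the density to vanish
    pointwise. *)
Lemma EF_degenerate F g h : EF F (fun y => h y * h y) = 0 ->
  EF F (fun y => g y * h y) = 0.
Proof.
have nz : 2 ^+ #|V| != 0 :> R by rewrite expf_neq0 // pnatr_eq0.
move=> /eqP; rewrite /EF /Ex mulf_eq0 invr_eq0 (negPf nz) orbF.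
have ge0 y : 0 <= h y * h y * dens F y.
  by rewrite mulr_ge0 ?dens_ge0 // -expr2 sqr_ge0.
rewrite psumr_eq0 // => /allP h0; rewrite big1 ?mul0r // => y _.
have := h0 y (mem_index_enum y); rewrite /= !mulf_eq0 orbb.
by case/orP=> /eqP ->; rewrite ?mulr0 ?mul0r.
Qed.

(* When the vector [w] to be projected out is null, the division by zero
   returns 0, which is the correct coefficient by [EF_degenerate]. *)
Lemma orthogonalize F (s : seq {set V}) h : exists2 a : {set V} -> R,
  (forall T, a T != 0 -> T \in s) &
  forall T, T \in s -> EF F (fun y => (h y + \sum_X a X * chi R X y) * chi R T y) = 0.
Proof.
elim: s h => [|S s IH] h; first by exists (fun=> 0) => // T; rewrite eqxx.
have [a1 a1s o1] := IH h; have [a2 a2s o2] := IH (chi R S).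
(* A Gram-Schmidt step: [u] and [w] are the residuals of [h] and [chi S] against [s], and [u - l w]
   is made orthogonal to [w] as well. *)
pose u y := h y + \sum_X a1 X * chi R X y.
pose w y := chi R S y + \sum_X a2 X * chi R X y.
pose l := EF F (fun y => u y * w y) / EF F (fun y => w y * w y).
exists (fun X => a1 X - l * ((X == S)%:R + a2 X)) => [T|].
  rewrite inE; case: (eqVneq T S) => //= _.
  case: (eqVneq (a1 T) 0) => [->|/a1s //]; case: (eqVneq (a2 T) 0) => [->|/a2s //].
  by rewrite addr0 mulr0 subr0 eqxx.
have e T : EF F (fun y => (h y + \sum_X (a1 X - l * ((X == S)%:R + a2 X)) * chi R X y) * chi R T y)
   = EF F (fun y => u y * chi R T y) - l * EF F (fun y => w y * chi R T y).
  rewrite addrC -mulNr -EFZD; apply: EF_ext => y; rewrite /u /w.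
  have -> : \sum_X (a1 X - l * ((X == S)%:R + a2 X)) * chi R X y =
     \sum_X a1 X * chi R X y - l * (chi R S y + \sum_X a2 X * chi R X y).
    have {1}-> : chi R S y = \sum_X (X == S)%:R * chi R X y.
      rewrite (bigD1 S) //= eqxx mul1r big1 ?addr0 // => X /negPf ->.
      by rewrite mul0r.
    rewrite -big_split /= mulr_sumr -sumrB; apply: eq_bigr => X _; ring.
  ring.
(* [w] differs from [chi S] only by characters in [s], so anything orthogonal to [s] pairs equally
   with both. *)
have ortho (v : cube -> R) : (forall T, T \in s -> EF F (fun y => v y * chi R T y) = 0) ->
    EF F (fun y => v y * w y) = EF F (fun y => v y * chi R S y).
  move=> hv; pose vT X y := v y * chi R X y.
  transitivity (1 * EF F (fun y => v y * chi R S y) + \sum_X a2 X * EF F (vT X)).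
    rewrite -EF_sum -EFZD; apply: EF_ext => y; rewrite /w mulrDr mul1r; congr (_ + _).
    by rewrite mulr_sumr; apply: eq_bigr => X _; rewrite /vT mulrCA.
  rewrite mul1r big1 ?addr0 // => X _.
  by case: (eqVneq (a2 X) 0) => [->|/a2s /hv ->]; rewrite ?mul0r ?mulr0.
move=> T; rewrite inE e => /orP[/eqP ->|Ts]; last first.
  by rewrite o1 // o2 // mulr0 subr0.
rewrite -(ortho u o1) -(ortho w o2).
case: (eqVneq (EF F (fun y => w y * w y)) 0) => [z|nz].
  by rewrite z mulr0 subr0 EF_degenerate.
by rewrite /l divfK // subrr.
Qed.

(** A linear order refining cardinality, with ties broken by enumeration; it makes the elimination
    triangular. *)
Definition rank S : nat := (#|S| * #|{set V}| + enum_rank S)%N.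

Lemma rank_inj : injective rank.
Proof.
move=> S T; rewrite /rank => e; apply: enum_rank_inj; apply: ord_inj.
have := congr1 (modn^~ #|{set V}|) e.
by rewrite /= !modnMDl !modn_small.
Qed.

Lemma rank_card S T : (rank S < rank T)%N -> (#|S| <= #|T|)%N.
Proof.
move=> lt; rewrite leqNgt; apply/negP => c.
have : (#|T|.+1 * #|{set V}| <= #|S| * #|{set V}|)%N by rewrite leq_mul2r c orbT.
move: (ltn_ord (enum_rank T)) lt; rewrite /rank mulSn; set m := #|_|.
move: (nat_of_ord (enum_rank S)) (nat_of_ord (enum_rank T)); clearbody m; lia.
Qed.

Lemma card_rank S T : (#|S| < #|T|)%N -> (rank S < rank T)%N.
Proof.
move=> c; have : (#|S|.+1 * #|{set V}| <= #|T| * #|{set V}|)%N by rewrite leq_mul2r c orbT.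
move: (ltn_ord (enum_rank S)); rewrite /rank mulSn; set m := #|_|.
move: (nat_of_ord (enum_rank S)) (nat_of_ord (enum_rank T)); clearbody m; lia.
Qed.

Lemma card_symdiff S T : (#|symdiff S T| <= #|S| + #|T|)%N.
Proof.
apply: leq_trans (leq_card_setU _ _).1; apply: subset_leq_card.
by apply/subsetP=> v; rewrite !inE; case: (v \in S); case: (v \in T).
Qed.

Lemma symdiff_sub S T N : S \subset N -> T \subset N -> symdiff S T \subset N.
Proof.
move=> /subsetP SN /subsetP TN; apply/subsetP => v; rewrite inE.
by case: (boolP (v \in S)) => [/SN //|_]; rewrite addFb => /TN.
Qed.

(** * Positivity of the moment matrix *)

Variable d : nat.
(** The [2 d] accommodates a product of two characters of size [d], the extra [k] the variables of
    one constraint. *)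
Hypothesis dkL : (2 * d + k <= L)%N.

Let dL : (2 * d <= L)%N.
Proof. exact: leq_trans (leq_addr _ _) dkL. Qed.

(** [a] holds the coefficients of [chi S] minus its projection onto the preceding characters inside
    [N]. To test a preceding [T], possibly not inside [N], the family is extended to one closed for
    [S :|: T]; every resulting term either leaves [N] and vanishes, or involves a preceding
    character inside [N]. *)
Lemma pseudo_orthogonal S : (#|S| <= d)%N -> exists2 a : {set V} -> R,
  a S = 1 /\ (forall T, a T != 0 -> T = S \/ (rank T < rank S)%N) &
  (forall T, (rank T < rank S)%N -> \sum_X a X * moment (symdiff X T) = 0) /\
  0 <= \sum_X \sum_Y a X * a Y * moment (symdiff X Y).
Proof.
move=> cS; have [F _ cF] : exists2 F : {set J}, set0 \subset F & closed S F.
  by apply: closed_exists; [exact: potential0|rewrite cards0].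
set N := S :|: vs F.
have [b bs bo] := orthogonalize F
  [seq T : {set V} <- enum {set V} | (T \subset N) && (rank T < rank S)%N] (chi R S).
have {}bs T : b T != 0 -> T \subset N /\ (rank T < rank S)%N.
  by move=> /bs; rewrite mem_filter => /andP[/andP[]].
have {}bo (T : {set V}) : T \subset N -> (rank T < rank S)%N ->
    EF F (fun y => (chi R S y + \sum_X b X * chi R X y) * chi R T y) = 0.
  by move=> TN rT; apply: bo; rewrite mem_filter TN rT mem_enum.
pose a X := (X == S)%:R + b X.
have aE y : \sum_X a X * chi R X y = chi R S y + \sum_X b X * chi R X y.
  rewrite /a; under eq_bigr => X _ do rewrite mulrDl.
  rewrite big_split /=; congr (_ + _).
  rewrite (bigD1 S) //= eqxx mul1r big1 ?addr0 // => X /negPf ->.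
  by rewrite mul0r.
have aC T : a T != 0 -> T = S \/ (rank T < rank S)%N.
  rewrite /a; case: (eqVneq T S) => [->|_]; first by left.
  by rewrite add0r => /bs[]; right.
have aN T : a T != 0 -> T \subset N.
  rewrite /a; case: (eqVneq T S) => [->|_]; first by rewrite subsetUl.
  by rewrite add0r => /bs[].
have acard T : a T != 0 -> (#|T| <= d)%N.
  by case/aC => [->|/rank_card/leq_trans ->].
pose h y := \sum_X a X * chi R X y.
have hN : in_span (fun X => X \subset N) h by exists a.
exists a; split => //.
- rewrite /a eqxx; case: (eqVneq (b S) 0) => [->|/bs[_]]; rewrite ?addr0 //.
  by rewrite ltnn.
- move=> T rT; set A := S :|: T.
  have cT : (#|T| <= #|S|)%N := rank_card rT.
  have cA : (#|A| <= L)%N by have := (leq_card_setU S T).1; rewrite -/A; lia.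
  (* Passing from [S] to [A] enlarges the union with [vs F] by at most the number of variables
     added, so the inequality persists and [F] extends to a family closed for [A]. *)
  have pA : potential A F.
    case: cF => [pF _ _]; move: pF; rewrite /potential.
    have e1 : (#|A :|: vs F| + #|S| <= #|S :|: vs F| + #|A|)%N.
      have -> : (#|A| = #|S| + #|T :\: S|)%N.
        rewrite -(cardsID S A); congr (_ + _)%N; apply: eq_card => v;
        by rewrite !inE; case: (v \in S); case: (v \in T).
      have : (#|A :|: vs F| <= #|S :|: vs F| + #|T :\: S|)%N.
        apply: leq_trans (leq_card_setU _ _).1; apply: subset_leq_card.
        apply/subsetP => v; rewrite !inE.
        by case: (v \in S); case: (v \in T); case: (v \in vs F).
      lia.
    move: e1; lia.
  have [F' sF cF'] := closed_exists pA (let: And3 _ c _ := cF in c).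
  have NN : N \subset A :|: vs F'.
    by rewrite /N /A setUSS ?vsS // subsetUl.
  have mE X : a X != 0 -> moment (symdiff X T) = EF F' (fun y => chi R X y * chi R T y).
    move=> aX; have sX := subset_trans (aN _ aX) NN.
    rewrite (@momentE A F') //; first by apply: EF_ext => y; rewrite chiM.
      by apply: leq_trans (card_symdiff _ _) _; have := acard _ aX; lia.
    by apply: symdiff_sub => //; rewrite /A; apply: subset_trans (subsetUl _ _); rewrite subsetUr.
  transitivity (EF F' (fun y => h y * chi R T y)).
    rewrite (@EF_ext _ _ (fun y => \sum_X a X * (chi R X y * chi R T y))); last first.
      by move=> y; rewrite /h mulr_suml; apply: eq_bigr => X _; rewrite mulrA.
    rewrite EF_sum; apply: eq_bigr => X _.
    by case: (eqVneq (a X) 0) => [->|/mE ->]; rewrite ?mul0r.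
  have o (U : {set V}) : U \subset N -> (rank U < rank S)%N -> EF F (fun y => h y * chi R U y) = 0.
    move=> UN rU; rewrite -(bo U UN rU); apply: EF_ext => y.
    by rewrite /h aE.
  have z (U : {set V}) : ((U \subset N) -> (rank U < rank S)%N) -> EF F (fun y => h y * chi R U y) = 0.
    move=> hU; case: (boolP (U \subset N)) => UN; first by apply: o => //; apply: hU.
    by apply: (@EF_vanish S F N) => //; rewrite subsetUr.
  have [r -> rC] := EF_extend h T cF sF (let: And3 _ c _ := cF' in c).
  rewrite z ?add0r // big1 // => X _.
  case: (eqVneq (r X) 0) => [->|/rC lt]; first by rewrite mul0r.
  (* If [symdiff X T] lies inside [N], then [X] and [T] agree outside [N]. As [X] has fewer elements
     inside [N] than outside, trading the outside part of [T] for the inside part of [X] strictly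
     lowers the cardinality. *)
  rewrite z ?mulr0 // => XTN; apply: card_rank; apply: leq_trans cT.
  rewrite -/N in lt.
  have e1 : X :\: N = T :\: N.
    apply/setP=> v; rewrite !in_setD; case: (boolP (v \in N)) => //= vN.
    have := contraNF (subsetP XTN v) vN; rewrite inE.
    by case: (v \in X); case: (v \in T).
  have e2 : (#|symdiff X T| <= #|X :&: N| + #|T :&: N|)%N.
    apply: leq_trans (leq_card_setU _ _).1; apply: subset_leq_card.
    apply/subsetP=> v vXT; have := vXT; rewrite in_setU !in_setI (subsetP XTN v vXT) inE.
    by case: (v \in X); case: (v \in T).
  by rewrite e1 in lt; have := cardsID N T; lia.
- have -> : \sum_X \sum_Y a X * a Y * moment (symdiff X Y) = EF F (fun y => h y * h y).
    rewrite (@EF_ext _ _ (fun y => \sum_X a X * (\sum_Y a Y * (chi R X y * chi R Y y)))).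
      rewrite EF_sum; apply: eq_bigr => X _.
      rewrite EF_sum mulr_sumr; apply: eq_bigr => Y _; rewrite -mulrA.
      case: (eqVneq (a X) 0) => [->|aX]; first by rewrite !mul0r.
      case: (eqVneq (a Y) 0) => [->|aY]; first by rewrite !mul0r.
      congr (_ * (_ * _)); rewrite (@momentE S F) //.
      - by apply: EF_ext => y; rewrite chiM.
      - by lia.
      - apply: leq_trans (card_symdiff _ _) _.
        by have := acard _ aX; have := acard _ aY; lia.
      - by apply: symdiff_sub; apply: aN.
    move=> y; rewrite {1}/h mulr_suml; apply: eq_bigr => X _.
    rewrite -mulrA; congr (_ * _); rewrite mulr_sumr; apply: eq_bigr => Y _.
    by rewrite mulrCA.
  rewrite /EF /Ex divr_ge0 ?exprn_ge0 ?ler0n // sumr_ge0 // => y _.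
  by rewrite mulr_ge0 ?dens_ge0 // -expr2 sqr_ge0.
Qed.

Definition form (g h : {set V} -> R) := \sum_X \sum_Y g X * h Y * moment (symdiff X Y).

(** Elimination of the leading set [S]: subtracting [g S] times the vector from [pseudo_orthogonal]
    kills both cross terms, the subtracted part has nonnegative square, and the remainder has a
    smaller rank bound. *)
Lemma form_ge0 (g : {set V} -> R) :
  (forall X, g X != 0 -> (#|X| <= d)%N) -> 0 <= form g g.
Proof.
have [B hB] : exists B, forall X, (rank X < B)%N.
  exists (\max_X rank X).+1 => X; rewrite ltnS; exact: leq_bigmax.
move=> gd; have {hB} : forall X, g X != 0 -> (rank X < B)%N by [].
elim: B g gd => [|B IH] g gd gB.
  rewrite /form big1 // => X _; rewrite big1 // => Y _.
  by case: (eqVneq (g X) 0) => [->|/gB //]; rewrite !mul0r.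
case: (pselect (exists2 S, g S != 0 & rank S = B)) => [[S gS rS]|no]; last first.
  apply: IH => // X gX; have := gB _ gX; rewrite ltnS leq_eqVlt => /orP[/eqP e|//].
  by case: no; exists X.
have [a [aS aC] [ao aa]] := pseudo_orthogonal (gd _ gS).
pose g' X := g X - g S * a X.
have g'B X : g' X != 0 -> (rank X < B)%N.
  rewrite /g'; case: (eqVneq X S) => [->|XS]; first by rewrite aS mulr1 subrr eqxx.
  case: (eqVneq (a X) 0) => [->|/aC[e|]].
  - rewrite mulr0 subr0 => /gB; rewrite ltnS leq_eqVlt => /orP[/eqP e|//].
    by case/eqP: XS; apply: rank_inj; rewrite e.
  - by rewrite e eqxx in XS.
  - by rewrite rS.
have g'd X : g' X != 0 -> (#|X| <= d)%N.
  move=> /g'B; rewrite -rS => /rank_card/leq_trans; apply; exact: gd.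
have := IH g' g'd g'B.
have ag' : \sum_X \sum_Y a X * g' Y * moment (symdiff X Y) = 0.
  rewrite exchange_big /= big1 // => Y _.
  transitivity (g' Y * \sum_X a X * moment (symdiff X Y)).
    by rewrite mulr_sumr; apply: eq_bigr => X _; ring.
  by case: (eqVneq (g' Y) 0) => [->|/g'B h]; rewrite ?mul0r // ao ?mulr0 // rS.
have g'a : \sum_X \sum_Y g' X * a Y * moment (symdiff X Y) = 0.
  rewrite -[RHS]ag' exchange_big; apply: eq_bigr => Y _; apply: eq_bigr => X _.
  by rewrite symdiffC; ring.
have -> : form g g = form g' g' + g S * (\sum_X \sum_Y g' X * a Y * moment (symdiff X Y))
   + g S * (\sum_X \sum_Y a X * g' Y * moment (symdiff X Y))
   + g S ^+ 2 * (\sum_X \sum_Y a X * a Y * moment (symdiff X Y)).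
  rewrite /form !mulr_sumr -!big_split /=; apply: eq_bigr => X _.
  rewrite !mulr_sumr -!big_split /=; apply: eq_bigr => Y _.
  rewrite /g'; ring.
rewrite g'a ag' !mulr0 !addr0 => h; apply: addr_ge0 => //.
by rewrite mulr_ge0 // sqr_ge0.
Qed.

(** The linear extension of [moment] through Fourier coefficients. It is total, but positivity and
    the constraints are only controlled in bounded degree. *)
Definition pexp g : R := \sum_U Ex (fun y => g y * chi R U y) * moment U.

Lemma pexp_ext g h : g =1 h -> pexp g = pexp h.
Proof.
by move=> e; apply: eq_bigr => U _; congr (_ * _); apply: Ex_ext => y; rewrite e.
Qed.

Lemma pexpZD a g h : pexp (fun y => a * g y + h y) = a * pexp g + pexp h.
Proof.
rewrite /pexp mulr_sumr -big_split /=; apply: eq_bigr => U _.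
rewrite (mulrA a) -ExZ -mulrDl -ExD; congr (_ * _); apply: Ex_ext => y; ring.
Qed.

Lemma pexp_sum (I : finType) (r : I -> R) (g : I -> cube -> R) :
  pexp (fun y => \sum_i r i * g i y) = \sum_i r i * pexp (g i).
Proof.
rewrite /pexp; under [RHS]eq_bigr => i _ do rewrite mulr_sumr.
rewrite exchange_big /=; apply: eq_bigr => U _.
under [RHS]eq_bigr => i _ do rewrite mulrA -ExZ.
rewrite -mulr_suml -Ex_sum; congr (_ * _); apply: Ex_ext => y.
by rewrite mulr_suml; apply: eq_bigr => i _; rewrite mulrA.
Qed.

Lemma pexp_chi U : pexp (chi R U) = moment U.
Proof.
rewrite /pexp (bigD1 U) //= Ex_chiM eqxx mul1r big1 ?addr0 // => X.
by rewrite eq_sym Ex_chiM => /negPf ->; rewrite mul0r.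
Qed.

Lemma pexp1 : pexp (fun=> 1) = 1.
Proof.
rewrite -[RHS]moment0 -pexp_chi; by apply: pexp_ext => y; rewrite chi0.
Qed.

Lemma pexp_mul (r s : {set V} -> R) :
  pexp (fun y => (\sum_X r X * chi R X y) * (\sum_Y s Y * chi R Y y)) = form r s.
Proof.
rewrite (@pexp_ext _ (fun y => \sum_X r X * (\sum_Y s Y * chi R (symdiff X Y) y))).
  rewrite pexp_sum; apply: eq_bigr => X _; rewrite pexp_sum mulr_sumr.
  by apply: eq_bigr => Y _; rewrite pexp_chi mulrA.
move=> y; rewrite mulr_suml; apply: eq_bigr => X _.
rewrite -mulrA; congr (_ * _); rewrite mulr_sumr; apply: eq_bigr => Y _.
by rewrite mulrCA chiM.
Qed.

Lemma pexp_ge0 g : in_span (fun X => (#|X| <= d)%N) g -> 0 <= pexp (fun y => g y ^+ 2).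
Proof.
move=> [r rE rC]; have -> : pexp (fun y => g y ^+ 2) = form r r.
  by rewrite -pexp_mul; apply: pexp_ext => y; rewrite -rE expr2.
exact: form_ge0.
Qed.

Hypothesis M_gt0 : (0 < M)%N.

(** Once [A] contains the variables of [f], the family [[set f]] touches nothing new, and
    [t <= 2 * k] gives it the potential inequality. A closed family containing [f] then computes all
    moments involved, and the factor [D f] of its density annihilates [q]. *)
Lemma pexp_constraint f q g : (t <= 2 * k)%N ->
  in_span (fun X => X \subset vars f) q -> (forall y, D f y * q y = 0) ->
  in_span (fun X => (#|X| <= 2 * d)%N) g -> pexp (fun y => q y * g y) = 0.
Proof.
move=> tk [r rE rC] Dq [s sE sC].
have -> : pexp (fun y => q y * g y) = form r s.
  by rewrite -pexp_mul; apply: pexp_ext => y; rewrite rE sE.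
rewrite /form exchange_big big1 // => W _ /=.
case: (eqVneq (s W) 0) => [->|/sC cW].
  by rewrite big1 // => X _; rewrite mulr0 mul0r.
pose A := W :|: vars f.
have cA : (#|A| <= L)%N.
  by have := (leq_card_setU W (vars f)).1; have := card_vars f; rewrite -/A; lia.
have [||F sF cF] := @closed_exists A [set f].
- rewrite /potential /vs big_set1 cards1 /A -setUA setUid; lia.
- by rewrite cards1.
have fF : f \in F by apply: (subsetP sF); rewrite inE.
transitivity (s W * \sum_X r X * EF F (fun y => chi R X y * chi R W y)).
  rewrite mulr_sumr; apply: eq_bigr => X _.
  case: (eqVneq (r X) 0) => [->|/rC sX]; first by rewrite !mul0r mulr0.
  have sub : symdiff X W \subset A.
    by apply: symdiff_sub; [apply: subset_trans sX _; rewrite subsetUr|rewrite subsetUl].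
  rewrite (@momentE A F) //.
  - rewrite mulrA [r X * _]mulrC; congr (_ * _).
    by apply: EF_ext => y; rewrite chiM.
  - exact: leq_trans (subset_leq_card sub) cA.
  - exact: subset_trans sub (subsetUl _ _).
rewrite -EF_sum (@EF_ext _ _ (fun y => q y * chi R W y)); last first.
  by move=> y; rewrite rE mulr_suml; apply: eq_bigr => X _; rewrite mulrA.
rewrite /EF (@Ex_ext _ _ _ (fun y => 0 * 1)) ?ExZ ?mul0r ?mulr0 // => y.
rewrite /dens (big_setD1 f) //= mulrA [_ * D f y]mulrC !mulrA Dq !mul0r.
by [].
Qed.

Lemma pseudo_functional_exists : exists E : (cube -> R) -> R,
  [/\ forall g h, g =1 h -> E g = E h,
      forall a g h, E (fun y => a * g y + h y) = a * E g + E h,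
      E (fun=> 1) = 1,
      forall g, in_span (fun X => (#|X| <= d)%N) g -> 0 <= E (fun y => g y ^+ 2) &
      forall f q g, (t <= 2 * k)%N -> in_span (fun X => X \subset vars f) q ->
        (forall y, D f y * q y = 0) -> in_span (fun X => (#|X| <= 2 * d)%N) g ->
        E (fun y => q y * g y) = 0].
Proof.
exists pexp; split.
- exact: pexp_ext.
- exact: pexpZD.
- exact: pexp1.
- exact: pexp_ge0.
- exact: pexp_constraint.
Qed.

End Closure.

(** * Pseudoexpectations on polynomials *)

Section Instances.

Set Implicit Arguments.
Unset Strict Implicit.
Unset Printing Implicit Defensive.

Lemma span_coef (R : realFieldType) (V : finType) (g : {ffun V -> bool} -> R) :
  in_span (fun X => Ex (fun y => g y * chi R X y) != 0) g.
Proof.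
have [r rE _] := span_all g.
have rX X : Ex (fun y => g y * chi R X y) = r X.
  rewrite (@Ex_ext _ _ _ (fun y => \sum_Y r Y * (chi R Y y * chi R X y))).
    rewrite Ex_sum (bigD1 X) //= ExZ Ex_chiM eqxx mulr1 big1 ?addr0 // => Y /negPf e.
    by rewrite ExZ Ex_chiM e mulr0.
  by move=> y; rewrite rE mulr_suml; apply: eq_bigr => Y _; rewrite mulrA.
by exists r => // X; rewrite rX.
Qed.

(** The negations [e] only multiply the coefficient at [Q] by the sign [chi Q e], and injectivity of
    [b] turns [chi Q] into the character of the image. *)
Lemma span_reindex (R : realFieldType) (I V : finType) (C : {set I} -> Prop)
    (g : {ffun I -> bool} -> R) (b : I -> V) (e : {ffun I -> bool}) :
  injective b -> in_span C g ->
  in_span (fun X => exists2 Q : {set I}, X = b @: Q & C Q)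
    (fun y : {ffun V -> bool} => g [ffun i => y (b i) (+) e i]).
Proof.
move=> bI [r rE rC].
pose F (Q : {set I}) (y : {ffun V -> bool}) := r Q * chi R Q e * chi R (b @: Q) y.
apply: (span_ext (g := fun y => \sum_Q F Q y)) => [y|].
  rewrite rE; apply: eq_bigr => Q _; rewrite /F -mulrA; congr (_ * _).
  rewrite /chi big_imset /=; last by move=> i j _ _ /bI.
  rewrite -big_split /=; apply: eq_bigr => i _.
  by rewrite ffunE signr_addb mulrC.
apply: span_sum => Q _; case: (eqVneq (r Q) 0) => [rQ|/rC cQ].
  by apply: span_ext (span0 _ _) => y; rewrite /F rQ !mul0r.
by apply: spanZ; apply: span_chi; exists Q.
Qed.

(** For [#|Q| < t] the Fourier coefficient at [Q] depends only on the marginal on [Q], which is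
    uniform, so it agrees with that of the constant 1. *)
Lemma wise_uniform_span (R : realType) (k t : nat) (nu : {ffun 'I_k -> bool} -> R) :
  (0 < t)%N -> is_distribution nu -> wise_uniform (t - 1) nu ->
  in_span (fun Q => (t <= #|Q|)%N) (fun a => 2 ^+ k * nu a - 1).
Proof.
move=> t0 [_ nu1] nuU; apply: spanW (span_coef _) => Q.
apply: contraNT; rewrite -ltnNge => Qt.
have nz : 2 ^+ k != 0 :> R by rewrite expf_neq0 // pnatr_eq0.
have -> : Ex (fun a => (2 ^+ k * nu a - 1) * chi R Q a) =
   2 ^+ k * Ex (fun a => nu a * chi R Q a) - Ex (chi R Q).
  rewrite -[- Ex _]mulN1r -!ExZ.
  by rewrite -(ExD (fun y => 2 ^+ k * (nu y * chi R Q y))); apply: Ex_ext => a; ring.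
have -> : 2 ^+ k * Ex (fun a => nu a * chi R Q a) = \sum_a nu a * chi R Q a.
  by rewrite /Ex card_ord mulrCA divff ?mulr1.
case: (eqVneq Q set0) => [->|Q0].
  rewrite (@Ex_ext _ _ _ (fun=> 1)) ?Ex1; last exact: chi0.
  by under eq_bigr => a _ do rewrite chi0 mulr1; rewrite nu1 subrr.
rewrite Ex_chi // subr0.
(* [p] clears the bits outside [Q]; its fixed points index the assignments of [Q]. *)
pose p (a : {ffun 'I_k -> bool}) : {ffun 'I_k -> bool} := [ffun i => (i \in Q) && a i].
have pQ a : chi R Q (p a) = chi R Q a.
  by apply: eq_bigr => i iQ; rewrite ffunE iQ.
rewrite (partition_big p predT) //=.
have -> : \sum_a \sum_(x | p x == a) nu x * chi R Q x =
  \sum_a (p a == a)%:R * 2 ^- #|Q| * chi R Q a.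
  apply: eq_bigr => a _; case: eqP => [pa|npa]; last first.
    rewrite mul0r mul0r big1 // => x /eqP px; case: npa.
    by apply/ffunP => i; rewrite -px !ffunE andbA andbb.
  have nuQ := nuU Q a; rewrite mul1r -nuQ ?mulr_suml; last first.
    by rewrite -ltnS subn1 prednK.
  apply: eq_big => [x|x /eqP px]; last by rewrite -(pQ x) px.
  apply/eqP/forallP => [px i|h].
    by apply/implyP => iQ; rewrite -px ffunE iQ.
  apply/ffunP => i; rewrite -pa !ffunE.
  by case: (boolP (i \in Q)) => // iQ; have := h i; rewrite iQ => /eqP ->.
have [v vQ] := set0Pn _ Q0.
(* Flipping a bit in [Q] commutes with [p], hence preserves its fixed points, and negates
   [chi Q]. *)
have : Ex (fun a => (p a == a)%:R * 2 ^- #|Q| * chi R Q a) = 0.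
  apply: (@Ex_flip _ _ v) => a; rewrite chi_flip vQ expr1.
  have -> : (p (flip v a) == flip v a) = (p a == a).
    have pf : p (flip v a) = flip v (p a).
      by apply/ffunP => i; rewrite !ffunE; case: eqP => [->|]; rewrite ?vQ.
    by rewrite pf (inj_eq (inv_inj (flipK v))).
  by rewrite mulN1r mulrN.
rewrite /Ex card_ord => /eqP; rewrite mulf_eq0 invr_eq0 (negPf nz) orbF.
by move=> /eqP ->.
Qed.

(** * Substituting bits of another cube into polynomials *)

Variables (R : realType) (n : nat) (V : finType).
Local Notation cube := {ffun V -> bool}.
Variable sigma : cube -> 'I_n -> bool.

Definition peval (p : {mpoly R[n]}) (y : cube) : R := p.@[fun i => (sigma y i)%:R].

Lemma pevalZD a p q y : peval (a *: p + q) y = a * peval p y + peval q y.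
Proof. by rewrite /peval mevalD mevalZ. Qed.

Lemma pevalM p q y : peval (p * q) y = peval p y * peval q y.
Proof. by rewrite /peval mevalM. Qed.

Lemma peval_multilin p y : peval (multilin p) y = peval p y.
Proof.
rewrite /peval /multilin [in RHS]mevalE raddf_sum /=; apply: eq_bigr => mo _.
rewrite mevalZ mevalX; congr (_ * _); apply: eq_bigr => i _.
rewrite mnmE; case: (sigma y i); rewrite ?expr1n //.
by rewrite !expr0n; case: (mo i).
Qed.

Hypothesis sigma_span : forall i,
  in_span (fun X : {set V} => (#|X| <= 1)%N) (fun y => (sigma y i)%:R : R).

(** Each substituted bit has degree at most one, so the substitution does not raise degrees. *)
Lemma peval_span p d : (deg p <= d)%N ->
  in_span (fun X : {set V} => (#|X| <= d)%N) (peval p).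
Proof.
move=> pd; apply: (span_ext (g := fun y => \sum_(m <- msupp p)
   p@_m * \prod_i (sigma y i)%:R ^+ m i)) => [y|]; first by rewrite /peval mevalE.
apply: span_sum => mo mop; apply: spanZ.
have : (mdeg mo <= d)%N.
  by apply: leq_trans pd; rewrite /deg; have := msize_mdeg_lt mop; case: (msize p).
rewrite mdegE; elim: (index_enum 'I_n) (d) => [|i s IH] d'.
  move=> _; apply: (span_ext (g := chi R set0)) => [y|]; first by rewrite chi0 big_nil.
  by apply: span_chi; rewrite cards0.
rewrite big_cons => le.
apply: (span_ext (g := fun y => (sigma y i)%:R ^+ mo i *
   \prod_(j <- s) (sigma y j)%:R ^+ mo j)) => [y|]; first by rewrite big_cons.
apply: (spanM (C1 := fun X : {set V} => (#|X| <= mo i)%N)) (IH (d' - mo i)%N _).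
- by move=> X Y hX hY; apply: leq_trans (card_symdiff _ _) _; lia.
- elim: (mo i) => [|c IHc].
    apply: (span_ext (g := chi R set0)) => [y|]; first by rewrite chi0 expr0.
    by apply: span_chi; rewrite cards0.
  apply: (span_ext (g := fun y => (sigma y i)%:R * (sigma y i)%:R ^+ c)) => [y|].
    by rewrite exprS.
  apply: spanM (sigma_span i) IHc => X Y hX hY.
  by apply: leq_trans (card_symdiff _ _) _; lia.
- lia.
Qed.

Variables (k t m : nat) (P : {ffun 'I_k -> bool} -> bool) (I : instance n k m).

Definition bits (y : cube) (f : 'I_m) : {ffun 'I_k -> bool} :=
  [ffun j => sigma y (sval (I f).1 j) (+) (I f).2 j].

Lemma peval_arith f y : peval (arith R P (I f)) y = (P (bits y f))%:R.
Proof.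
have lit j : peval (literal R (I f) j) y = (bits y f j)%:R.
  rewrite /peval /literal /bits ffunE; case: ((I f).2 j).
    by rewrite mevalB meval1 mevalXU; case: (sigma y _); rewrite /= ?subr0 ?subrr.
  by rewrite mevalXU addbF.
rewrite /peval /arith raddf_sum /=.
rewrite (eq_bigr (fun a : {ffun 'I_k -> bool} => (a == bits y f)%:R)); last first.
  move=> a _; rewrite rmorph_prod /=; case: eqP => [->|ne].
    apply: big1 => j _; case e: (bits y f j); first by have := lit j; rewrite e.
    by rewrite mevalB meval1; have := lit j; rewrite e /peval => ->; rewrite subr0.
  have [j hj] : exists j, a j != bits y f j.
    apply/existsP; rewrite -negb_forall; apply/negP=> /forallP h.
    by apply: ne; apply/ffunP=> j; apply/eqP.
  rewrite (bigD1 j) //=; have := lit j; rewrite /peval.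
  move: hj; case: (a j) (bits y f j) => [] [] //= _ e.
    by rewrite e mul0r.
  by rewrite mevalB meval1 e subrr mul0r.
rewrite big_mkcond /= (bigD1 (bits y f)) //= eqxx big1 ?addr0; first by case: (P _).
by move=> a /negPf ->; case: (P a).
Qed.

Variables (b : 'I_n -> V) (s : 'I_n -> bool).

(** The functional built from the constraint densities is pulled back along [sigma]. Only variables
    occurring in constraints must be literals [y (b i) (+) s i]. The last clause yields
    pseudovariance zero for any polynomial that the substitution makes constant. *)
Lemma pseudoexpectation_exists (nu : {ffun 'I_k -> bool} -> R) (M L d : nat) (delta : R) :
  (0 < t)%N -> is_distribution nu -> wise_uniform (t - 1) nu ->
  \sum_x nu x * (P x)%:R = 1 ->
  (forall f y j, sigma y (sval (I f).1 j) =
     y (b (sval (I f).1 j)) (+) s (sval (I f).1 j)) ->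
  (forall f, injective (fun j => b (sval (I f).1 j))) ->
  0 < delta ->
  (forall F : {set 'I_m}, (#|F| <= M)%N ->
    (2 * k%:R + 2 * delta) * #|F|%:R <=
    2 * #|\bigcup_(f in F) [set b (sval (I f).1 j) | j : 'I_k]|%:R + t%:R * #|F|%:R) ->
  2 * L%:R <= delta * M%:R -> (2 * d + k <= L)%N -> (0 < M)%N ->
  exists Et : {mpoly R[n]} -> R,
    [/\ is_pseudoexpectation (2 * d) Et, satisfies_instance P I (2 * d) Et &
        forall q c, (forall y, peval q y = c) -> Et q = c].
Proof.
move=> t0 nuD nuU nuP sigE bI delta0 expan leLM dkL M0.
pose vars f := [set b (sval (I f).1 j) | j : 'I_k].
pose D f (y : cube) : R := 2 ^+ k * nu (bits y f).
have pull (C : {set 'I_k} -> Prop) f (g : {ffun 'I_k -> bool} -> R) : in_span C g ->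
    in_span (fun X => exists2 Q : {set 'I_k}, X = (fun j => b (sval (I f).1 j)) @: Q & C Q)
      (fun y => g (bits y f)).
  move=> /(span_reindex [ffun j => s (sval (I f).1 j) (+) (I f).2 j] (@bI f)) h.
  apply: span_ext h => y; congr (g _); apply/ffunP => j.
  by rewrite !ffunE sigE addbA.
have imS f (Q : {set 'I_k}) : (fun j => b (sval (I f).1 j)) @: Q \subset vars f.
  by apply/subsetP => v /imsetP[j _ ->]; apply/imsetP; exists j.
have D_ge0 f y : 0 <= D f y.
  by rewrite mulr_ge0 ?exprn_ge0 ?ler0n //; case: nuD.
have cardv f : (#|vars f| <= k)%N.
  by rewrite /vars (leq_trans (leq_imset_card _ _)) // card_ord.
have D_span f : in_span (fun X => X \subset vars f /\ (t <= #|X|)%N) (fun y => D f y - 1).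
  apply: spanW (pull _ f _ (wise_uniform_span t0 nuD nuU)) => X [Q -> tQ].
  by split => //; rewrite card_imset //; apply: bI.
have [E [Eext EZD E1 Ege0 Econ]] :=
  pseudo_functional_exists cardv D_ge0 D_span delta0 expan leLM dkL M0.
have E0 : E (fun=> 0) = 0.
  have := EZD 0 (fun=> 0) (fun=> 0); rewrite mul0r add0r => h.
  by have := EZD 1 (fun=> 0) (fun=> 0); rewrite !mul1r addr0; lra.
exists (fun p => E (peval p)); split; first split.
- by move=> a p q _ _; rewrite -EZD; apply: Eext => y; rewrite pevalZD.
- by move=> Q _; apply: Eext => y; rewrite peval_multilin.
- by rewrite -[RHS]E1; apply: Eext => y; rewrite /peval meval1.
- move=> Q dQ; rewrite (Eext _ (fun y => peval Q y ^+ 2)).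
    by apply: Ege0; apply: peval_span; lia.
  by move=> y; rewrite !expr2 pevalM.
- move=> f T dT.
  pose q (a : {ffun 'I_k -> bool}) : R := (P a)%:R - 1.
  rewrite (Eext _ (fun y => q (bits y f) * peval T y)); last first.
    move=> y; rewrite pevalM; congr (_ * _).
    by rewrite /q -peval_arith /peval mevalB mevalC.
  (* As [P] has [nu]-expectation 1, [nu] vanishes wherever [P] fails. *)
  have nuq a : nu a * q a = 0.
    have z : \sum_x nu x * (1 - (P x)%:R) = 0.
      case: nuD => _ nu1; under eq_bigr => x _ do rewrite mulrBr mulr1.
      by rewrite sumrB nu1 nuP subrr.
    have ge0 x : 0 <= nu x * (1 - (P x)%:R).
      rewrite mulr_ge0 //; first by case: nuD.
      by case: (P x); rewrite ?subrr ?subr0.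
    move: z => /eqP; rewrite psumr_eq0 // => /allP /(_ a (mem_index_enum a)) /eqP h.
    by rewrite /q -opprB mulrN h oppr0.
  case: (leqP t (2 * k)) => tk.
    apply: (Econ f) => //.
    + by apply: spanW (pull _ f _ (span_all q)) => X [Q -> _].
    + by move=> y; rewrite /D -mulrA nuq mulr0.
    + by apply: peval_span; lia.
  (* If [t > 2 k], no set of positions has [t] elements, so [nu] is uniform and nowhere zero, and
     [P] holds everywhere. *)
  rewrite -[RHS]E0; apply: Eext => y; rewrite -[RHS](mul0r (peval T y)); congr (_ * _).
  have [r rE rC] := wise_uniform_span t0 nuD nuU.
  have := rE (bits y f); rewrite big1 => [|Q _]; last first.
    case: (eqVneq (r Q) 0) => [->|/rC]; first by rewrite mul0r.
    by move=> tQ; have := leq_trans tQ (max_card _); rewrite card_ord; lia.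
  move=> e; have := nuq (bits y f) => /eqP; rewrite mulf_eq0 => /orP[/eqP z|/eqP //].
  by move: e; rewrite z mulr0; lra.
- move=> q c qc; have -> : c = E (fun y => c * 1 + 0).
    by rewrite (EZD c (fun=> 1) (fun=> 0)) E1 E0 mulr1 addr0.
  by apply: Eext => y; rewrite qc mulr1 addr0.
Qed.

End Instances.

(** * Pairing the variables *)

Section Pairing.

Set Implicit Arguments.
Unset Strict Implicit.
Unset Printing Implicit Defensive.

Lemma injection_exists (T : finType) (A W : {set T}) : (#|A| <= #|W|)%N ->
  exists2 w : T -> T, {in A &, injective w} & forall a, a \in A -> w a \in W.
Proof.
move=> AW; exists (fun a => nth a (enum W) (index a (enum A))) => [a a' aA a'A|a aA].
  have lt x : x \in A -> (index x (enum A) < size (enum W))%N.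
    by move=> xA; rewrite -cardE (leq_trans _ AW) // cardE index_mem mem_enum.
  rewrite (set_nth_default a') ?lt // => /eqP.
  rewrite nth_uniq ?lt ?enum_uniq // => /eqP e.
  by rewrite -[a](nth_index a (s := enum A)) ?mem_enum // e nth_index ?mem_enum.
rewrite -[_ \in W]mem_enum mem_nth // -cardE (leq_trans _ AW) //.
by rewrite cardE index_mem mem_enum.
Qed.

Lemma subset_of_card (T : finType) (X : {set T}) r : (r <= #|X|)%N ->
  exists2 Z : {set T}, Z \subset X & #|Z| = r.
Proof.
move=> rX; exists [set x in take r (enum X)].
  by apply/subsetP => x; rewrite inE => /mem_take; rewrite mem_enum.
by rewrite cardsE (card_uniqP _) ?take_uniq ?enum_uniq // size_takel // -cardE.
Qed.

Variables (n k m : nat) (I : instance n k m).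
Implicit Types (i j : 'I_n) (f : 'I_m).

Definition scope_set f := [set sval (I f).1 j | j : 'I_k].

Definition cell i := if (i < rev_ord i)%N then i else rev_ord i.

(** The variables that cannot be identified with their partner; for odd [n] the middle variable is
    its own partner. *)
Definition lonely := [set i | (i == rev_ord i) ||
  [exists f, (i \in scope_set f) && (rev_ord i \in scope_set f)]].

Definition isolated := [set i | (i != rev_ord i) &&
  [forall f, (i \notin scope_set f) && (rev_ord i \notin scope_set f)]].

Lemma rev_neq_lt i : i != rev_ord i -> (rev_ord i < i)%N = ~~ (i < rev_ord i)%N.
Proof.
move=> ne; rewrite -leqNgt ltn_neqAle; case: eqP => // e.
by case/eqP: ne; apply: ord_inj.
Qed.

Lemma cell_rev i : cell (rev_ord i) = cell i.
Proof.
rewrite /cell rev_ordK; case: (eqVneq i (rev_ord i)) => [<- //|/rev_neq_lt ->].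
by case: ltnP.
Qed.

Lemma cellE i : cell i = i \/ cell i = rev_ord i.
Proof. by rewrite /cell; case: ifP; [left|right]. Qed.

Lemma cell_idem i : cell (cell i) = cell i.
Proof. by case: (cellE i) => e; rewrite e ?cell_rev e. Qed.

Lemma cell_eq i j : cell i = cell j -> i = j \/ i = rev_ord j.
Proof.
case: (cellE i) => ->; case: (cellE j) => -> e; [by left|by right| |].
  by right; rewrite -e rev_ordK.
by left; apply: rev_ord_inj.
Qed.

Lemma lonely_rev i : (rev_ord i \in lonely) = (i \in lonely).
Proof.
rewrite !inE rev_ordK eq_sym; congr (_ || _).
by apply: eq_existsb => f; rewrite andbC.
Qed.

Lemma isolated_rev i : (rev_ord i \in isolated) = (i \in isolated).
Proof.
rewrite !inE rev_ordK eq_sym; congr (_ && _).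
by apply: eq_forallb => f; rewrite andbC.
Qed.

Lemma isolated_not_lonely i : i \in isolated -> i \notin lonely.
Proof.
rewrite !inE => /andP[/negPf -> /forallP h]; apply/existsP => -[f].
by have /andP[/negPf ->] := h f.
Qed.

Definition base i := if i \in lonely then i else cell i.

Lemma cell_base i : cell (base i) = cell i.
Proof. by rewrite /base; case: ifP => // _; rewrite cell_idem. Qed.

(** Distinct variables of one scope with equal cells are partners, hence lonely, and then each keeps
    its own coordinate. *)
Lemma base_inj f : injective (fun j : 'I_k => base (sval (I f).1 j)).
Proof.
move=> j j' /= e; apply: (injectiveP _ (svalP (I f).1)).
have := congr1 cell e; rewrite !cell_base => /cell_eq[//|e'].
have sc x : sval (I f).1 x \in scope_set f by apply/imsetP; exists x.
have l : sval (I f).1 j' \in lonely.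
  rewrite inE; apply/orP; right; apply/existsP; exists f.
  by rewrite sc -e' sc.
by move: e; rewrite /base e' lonely_rev l.
Qed.

(** [cell] factors through [base], so identifying all partners, even lonely ones, can only lose
    variables. Expansion may thus be proved for [cell], which does not depend on the instance. *)
Lemma card_base_ge (F : {set 'I_m}) :
  (#|\bigcup_(f in F) (cell @: scope_set f)| <=
   #|\bigcup_(f in F) [set base (sval (I f).1 j) | j : 'I_k]|)%N.
Proof.
apply: leq_trans (leq_imset_card cell _); apply: subset_leq_card.
apply/subsetP => v /bigcupP[f fF /imsetP[i /imsetP[j _ ->] ->]].
rewrite -cell_base; apply: imset_f; apply/bigcupP; exists f => //.
by apply/imsetP; exists j.
Qed.

Definition paired := ~: (lonely :|: isolated).

Lemma paired_rev i : (rev_ord i \in paired) = (i \in paired).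
Proof. by rewrite !in_setC !in_setU lonely_rev isolated_rev. Qed.

Lemma paired_neq i : i \in paired -> i != rev_ord i.
Proof. by rewrite in_setC in_setU inE; case: eqP. Qed.

Definition upper i := (i \notin lonely) && ~~ (i < rev_ord i)%N.

Lemma upper_rev i : i \in paired -> upper (rev_ord i) = ~~ upper i.
Proof.
move=> ip; rewrite /upper lonely_rev rev_ordK (rev_neq_lt (paired_neq ip)).
by move: ip; rewrite in_setC in_setU => /norP[-> _].
Qed.

(** Needed for the weight [#|paired| / 2] of the pairs to be an integer. *)
Lemma card_paired : #|paired| = (2 * #|[set i in paired | ~~ upper i]|)%N.
Proof.
have e : [set i in paired | upper i] = @rev_ord n @: [set i in paired | ~~ upper i].
  apply/setP => i; apply/idP/imsetP => [|[j]]; rewrite [in X in X -> _]inE => /andP[ip ui].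
    by exists (rev_ord i); rewrite ?rev_ordK // inE paired_rev ip upper_rev // negbK.
  by move=> ->; rewrite inE paired_rev ip upper_rev.
rewrite -(cardsID [set i | upper i] paired) mul2n -addnn; congr (_ + _)%N.
  rewrite -[RHS](card_imset _ (@rev_ord_inj n)) -e; apply: eq_card => i.
  by rewrite in_setI inE [RHS]inE.
by apply: eq_card => i; rewrite in_setD inE [RHS]inE andbC.
Qed.

Variable R : realType.

(** * The substitution of constant Hamming weight *)

Section Assignment.

Variables (w : 'I_n -> 'I_n) (Z : {set 'I_n}).
Hypotheses (w_inj : {in lonely &, injective w})
  (w_iso : forall a, a \in lonely -> w a \in isolated)
  (Z_sub : Z \subset isolated :\: w @: lonely).

(** Each lonely [a] is compensated by its own isolated variable [w a], which gets the opposite bit.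
    The other isolated variables are constants, equal to 1 exactly on [Z], and partners among the
    paired variables get opposite bits. *)
Definition assign (y : {ffun 'I_n -> bool}) i : bool :=
  if i \in isolated then
    if [pick a in lonely | w a == i] is Some a then ~~ y a else i \in Z
  else y (base i) (+) upper i.

Lemma span_bit v c : in_span (fun X : {set 'I_n} => (#|X| <= 1)%N)
  (fun y : {ffun 'I_n -> bool} => (y v (+) c)%:R : R).
Proof.
apply: (span_ext (g := fun y => 2^-1 * chi R set0 y + (- (-1) ^+ c / 2) * chi R [set v] y)).
  by move=> y; rewrite chi0 chi1; case: (y v); case: c => /=; rewrite ?expr0 ?expr1; lra.
by apply: spanD; apply: spanZ; apply: span_chi; rewrite ?cards0 ?cards1.
Qed.

Lemma assign_span i : in_span (fun X : {set 'I_n} => (#|X| <= 1)%N)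
  (fun y => (assign y i)%:R : R).
Proof.
rewrite /assign; case: (i \in isolated); last exact: span_bit.
case: [pick a in lonely | w a == i] => [a|].
  apply: (span_ext (g := fun y => (y a (+) true)%:R)) => [y|]; last exact: span_bit.
  by rewrite addbT.
apply: (span_ext (g := fun y => (i \in Z)%:R * chi R set0 y)) => [y|].
  by rewrite chi0 mulr1.
by apply: spanZ; apply: span_chi; rewrite cards0.
Qed.

Lemma assign_lonely y a : a \in lonely -> assign y a = y a.
Proof.
move=> al; have : a \notin isolated by apply: contraL al => /isolated_not_lonely.
by rewrite /assign /base /upper al => /negPf ->; rewrite addbF.
Qed.

Lemma assign_w y a : a \in lonely -> assign y (w a) = ~~ y a.
Proof.
move=> al; rewrite /assign w_iso //; case: pickP => [a' /andP[a'l /eqP e]|/(_ a)].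
  by rewrite (w_inj a'l al e).
by rewrite al eqxx.
Qed.

Lemma assign_rest y i : i \in isolated :\: w @: lonely -> assign y i = (i \in Z).
Proof.
rewrite inE => /andP[niw ii]; rewrite /assign ii.
case: pickP => // a /andP[al /eqP e]; case/negP: niw.
by rewrite -e imset_f.
Qed.

Lemma assign_rev y i : i \in paired -> assign y (rev_ord i) = ~~ assign y i.
Proof.
move=> ip; have := ip; rewrite in_setC in_setU => /norP[/negPf nl /negPf ni].
rewrite /assign isolated_rev ni /base lonely_rev nl cell_rev upper_rev //.
by rewrite addbN.
Qed.

(** A lonely variable and its compensator sum to 1, as do the two members of a pair. *)
Lemma assign_weight y : \sum_i (assign y i)%:R =
  #|lonely|%:R + #|Z|%:R + #|paired|%:R / 2 :> R.
Proof.
have split_sum (F : 'I_n -> R) : \sum_i F i =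
    \sum_(i in lonely) F i + \sum_(i in isolated) F i + \sum_(i in paired) F i.
  rewrite [LHS](bigID (mem (lonely :|: isolated))) /=; congr (_ + _).
    rewrite -bigU /=; first by apply: eq_bigl => i; rewrite !inE.
    rewrite disjoint_sym disjoint_subset; apply/subsetP => i ii.
    by rewrite inE isolated_not_lonely.
  by apply: eq_bigl => i; rewrite [RHS]in_setC.
rewrite split_sum; congr (_ + _).
- have -> : \sum_(i in isolated) (assign y i)%:R =
     \sum_(i in lonely) (~~ y i)%:R + #|Z|%:R :> R.
    rewrite (big_setID (w @: lonely)) /=; congr (_ + _).
      have -> : isolated :&: w @: lonely = w @: lonely.
        by apply/setIidPr/subsetP => i /imsetP[a al ->]; apply: w_iso.
      by rewrite big_imset //=; apply: eq_bigr => a al; rewrite assign_w.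
    rewrite (eq_bigr (fun i => if i \in Z then 1 else 0)) => [|i hi]; last first.
      by rewrite assign_rest //; case: (i \in Z).
    rewrite -big_mkcondr /= sumr_const; congr (_ *+ _); apply: eq_card => i.
    by rewrite -topredE /=; case: (boolP (i \in Z)) => [/(subsetP Z_sub) ->|]; rewrite ?andbF.
  rewrite addrA; congr (_ + _); rewrite -big_split /= -sumr_const; apply: eq_bigr => a al.
  by rewrite assign_lonely //; case: (y a); rewrite ?addr0 ?add0r.
- have : \sum_(i in paired) ((assign y i)%:R + (assign y (rev_ord i))%:R) = #|paired|%:R :> R.
    rewrite -sumr_const; apply: eq_bigr => i ip.
    by rewrite assign_rev //; case: (assign y i); rewrite ?addr0 ?add0r.
  rewrite big_split /= => h.
  have : \sum_(i in paired) (assign y (rev_ord i))%:R = \sum_(i in paired) (assign y i)%:R :> R.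
    rewrite [RHS](reindex_inj rev_ord_inj) /=; apply: eq_bigl => i.
    by rewrite paired_rev.
  by lra.
Qed.

End Assignment.

Lemma partition_card : (#|lonely| + #|isolated| + #|paired| = n)%N.
Proof.
rewrite -[RHS]card_ord -(cardsC (lonely :|: isolated)); congr (_ + _)%N.
apply/esym/eqP; rewrite (leq_card_setU _ _).2.
rewrite disjoint_sym disjoint_subset; apply/subsetP => i ii.
by rewrite inE isolated_not_lonely.
Qed.

Lemma weighted_pseudoexpectation (t : nat) (P : {ffun 'I_k -> bool} -> bool)
    (nu : {ffun 'I_k -> bool} -> R) (M L d : nat) (delta : R) (B : int) :
  (0 < t)%N -> is_distribution nu -> wise_uniform (t - 1) nu ->
  \sum_x nu x * (P x)%:R = 1 -> 0 < delta ->
  (forall F : {set 'I_m}, (#|F| <= M)%N ->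
    (2 * k%:R + 2 * delta) * #|F|%:R <=
    2 * #|\bigcup_(f in F) (cell @: scope_set f)|%:R + t%:R * #|F|%:R) ->
  2 * L%:R <= delta * M%:R -> (2 * d + k <= L)%N -> (0 < M)%N ->
  2 * `|B%:~R - n%:R / 2| + #|lonely|%:R <= #|isolated|%:R :> R ->
  exists Et : {mpoly R[n]} -> R,
    [/\ is_pseudoexpectation (2 * d) Et, satisfies_instance P I (2 * d) Et &
        satisfies_pseudovar0 Et (hamming_weight R n) B%:~R].
Proof.
move=> t0 nuD nuU nuP delta0 expan leLM dkL M0 hB.
have le : (#|lonely| <= #|isolated|)%N.
  by rewrite -(ler_nat R); apply: le_trans hB; rewrite lerDr mulr_ge0.
have [w w_inj w_iso] := injection_exists le.
set q := #|[set i in paired | ~~ upper i]|.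
have pq : #|paired| = (2 * q)%N := card_paired.
have nE : n%:R = #|lonely|%:R + #|isolated|%:R + 2 * q%:R :> R.
  have /(congr1 (GRing.natmul (1 : R))) := partition_card.
  by rewrite pq natrD natrD natrM => <-.
have cw : #|isolated :\: w @: lonely| = (#|isolated| - #|lonely|)%N.
  have <- : #|w @: lonely| = #|lonely| by rewrite card_in_imset.
  rewrite cardsD (setIidPr _) //.
  by apply/subsetP => i /imsetP[a al ->]; apply: w_iso.
(* The number of constants to be set to 1; the hypothesis on [B] says precisely that it lies between
   0 and [#|isolated| - #|lonely|]. *)
pose z : int := B - (#|lonely| + q)%:Z.
have zE : z%:~R = B%:~R - #|lonely|%:R - q%:R :> R.
  by rewrite /z rmorphB /= -pmulrn natrD; ring.
have h := ler_norm (B%:~R - n%:R / 2 : R).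
have h' := ler_norm (- (B%:~R - n%:R / 2) : R); rewrite normrN in h'.
have z0 : 0 <= z by rewrite -(ler_int R) zE; lra.
have [r zr] : exists r : nat, z = r by exists `|z|%N; rewrite gez0_abs.
have rE : r%:R = z%:~R :> R by rewrite zr pmulrn.
have [Z Z_sub cZ] : exists2 Z : {set 'I_n}, Z \subset isolated :\: w @: lonely & #|Z| = r.
  apply: subset_of_card; rewrite cw -(ler_nat R) natrB // rE zE; lra.
have sE f y (j : 'I_k) : assign w Z y (sval (I f).1 j) =
    y (base (sval (I f).1 j)) (+) upper (sval (I f).1 j).
  rewrite /assign; case: ifP => //.
  by rewrite inE => /andP[_ /forallP/(_ f)]; rewrite imset_f.
have ex (F : {set 'I_m}) : (#|F| <= M)%N -> (2 * k%:R + 2 * delta) * #|F|%:R <=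
    2 * #|\bigcup_(f in F) [set base (sval (I f).1 j) | j : 'I_k]|%:R + t%:R * #|F|%:R.
  move=> cF; apply: le_trans (expan F cF) _.
  by rewrite lerD2r ler_pM2l // ler_nat card_base_ge.
have [Et [pe si ev]] := pseudoexpectation_exists (@assign_span w Z) t0 nuD nuU nuP
   sE base_inj delta0 ex leLM dkL M0.
exists Et; split=> //.
have weight y : peval (assign w Z) (hamming_weight R n) y = B%:~R.
  rewrite /peval /hamming_weight raddf_sum /=.
  rewrite (eq_bigr (fun i => (assign w Z y i)%:R)) => [|i _]; last by rewrite mevalXU.
  by rewrite assign_weight // cZ rE zE pq natrM; lra.
split; apply: ev => y; first exact: weight.
by rewrite !expr2 pevalM weight.
Qed.

End Pairing.
Arguments cell {n} i.

(** * Expansion of random instances *)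

Section Counting.

Set Implicit Arguments.
Unset Strict Implicit.
Unset Printing Implicit Defensive.

(** Independence of the values at different arguments, cleared of denominators. *)
Lemma card_ffun_in (J T : finType) (F : {set J}) (X : {set T}) :
  (#|[set g : {ffun J -> T} | [forall f in F, g f \in X]]| * #|T| ^ #|F| =
    #|X| ^ #|F| * #|{ffun J -> T}|)%N.
Proof.
have -> : #|[set g : {ffun J -> T} | [forall f in F, g f \in X]]| =
    #|family (fun f => if f \in F then mem X else mem predT)|.
  apply: eq_card => g; rewrite inE; apply/forall_inP/familyP => [h f|h f fF].
    by case: (boolP (f \in F)) => [/h|].
  by have := h f; rewrite fF.
rewrite card_family foldrE big_map big_enum /= (bigID (mem F)) /=.
rewrite (eq_bigr (fun=> #|X|)) => [|f ->] //.
rewrite [X in (_ * X * _)%N](eq_bigr (fun=> #|T|)) => [|f /negPf ->] //.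
rewrite !prod_nat_const card_ffun -mulnA -expnD; congr (_ * _ ^ _)%N.
by rewrite addnC; apply: cardC.
Qed.

Variables (R : realType) (n k : nat).
Hypothesis kn : (k <= n)%N.

Lemma ffact_neq0 : ((n ^_ k)%:R : R) != 0.
Proof. by rewrite pnatr_eq0 -lt0n ffact_gt0. Qed.

Definition within (U : {set 'I_n}) : {set constraint n k} :=
  [set C : constraint n k | [forall j, sval C.1 j \in U]].

Lemma card_scopes (U : {set 'I_n}) :
  #|[set v : scope n k | [forall j, sval v j \in U]]| = (#|U| ^_ k)%N.
Proof.
rewrite -[X in (_ ^_ X)%N]card_ord -card_inj_ffuns_on.
rewrite -(card_imset _ val_inj); apply: eq_card => g; rewrite [RHS]inE.
apply/imsetP/andP => [[v]|[/ffun_onP gU gi]].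
  by rewrite inE => /forallP vU ->; split; [apply/ffun_onP|exact: valP v].
by exists (Sub g gi) => //; rewrite inE; apply/forallP.
Qed.

Lemma card_within (U : {set 'I_n}) : #|within U| = (#|U| ^_ k * 2 ^ k)%N.
Proof.
rewrite -card_scopes -[X in (2 ^ X)%N]card_ord -card_bool -card_ffun -cardsT -cardsX.
by apply: eq_card => -[v e]; rewrite !inE /= andbT.
Qed.

Lemma card_constraint : #|{: constraint n k}| = (n ^_ k * 2 ^ k)%N.
Proof.
have := card_within [set: 'I_n]; rewrite cardsT card_ord => <-; apply: eq_card => C.
by rewrite !inE; apply/esym/forallP => j; rewrite inE.
Qed.

Variable m : nat.

Lemma instance_gt0 : (0 < #|{: instance n k m}|)%N.
Proof.
rewrite card_ffun expn_gt0 card_constraint muln_gt0 expn_gt0.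
by rewrite ffact_gt0 kn.
Qed.

Definition pr (E : {set instance n k m}) : R := #|E|%:R / #|{: instance n k m}|%:R.

Lemma instance_neq0 : #|{: instance n k m}|%:R != 0 :> R.
Proof. by rewrite pnatr_eq0 -lt0n instance_gt0. Qed.


Lemma prS (E E' : {set instance n k m}) : E \subset E' -> pr E <= pr E'.
Proof. by move=> s; rewrite ler_wpM2r ?invr_ge0 // ler_nat subset_leq_card. Qed.

Lemma pr_union (I : finType) (Q : pred I) (E : I -> {set instance n k m}) :
  pr (\bigcup_(i | Q i) E i) <= \sum_(i | Q i) pr (E i).
Proof.
rewrite /pr -mulr_suml ler_wpM2r ?invr_ge0 // -natr_sum ler_nat.
elim/big_rec2: _ => [|i a b _ h]; first by rewrite cards0.
by apply: leq_trans (leq_card_setU _ _).1 _; rewrite leq_add2l.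
Qed.

Lemma pr_forall (F : {set 'I_m}) (X : {set constraint n k}) :
  pr [set I : instance n k m | [forall f in F, I f \in X]] =
  (#|X|%:R / #|{: constraint n k}|%:R) ^+ #|F|.
Proof.
have nz : #|{: constraint n k}|%:R != 0 :> R.
  by rewrite card_constraint natrM mulf_neq0 ?ffact_neq0 // natrX expf_neq0 // pnatr_eq0.
have := card_ffun_in F X => /(congr1 (GRing.natmul (1 : R))).
rewrite !natrM !natrX /pr => e; rewrite expr_div_n.
apply/eqP; rewrite eqr_div ?instance_neq0 ?expf_neq0 //; exact/eqP.
Qed.

Lemma pr_within (F : {set 'I_m}) (U : {set 'I_n}) :
  pr [set I : instance n k m | [forall f in F, I f \in within U]] =
  ((#|U| ^_ k)%:R / (n ^_ k)%:R) ^+ #|F|.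
Proof.
rewrite pr_forall card_within card_constraint !natrM; congr (_ ^+ _).
by rewrite -mulf_div divff ?mulr1 // natrX expf_neq0 // pnatr_eq0.
Qed.

(** Factor by factor, [(u - j) / (n - j) <= u / n] when [u <= n]. *)
Lemma ffact_ratio_le (u v : nat) : (u <= n)%N -> (u <= v)%N ->
  ((u ^_ k)%:R / (n ^_ k)%:R : R) <= (v%:R / n%:R) ^+ k.
Proof.
move=> un uv; case: (posnP n) => [n0|n0].
  move: kn un; rewrite n0 !leqn0 => /eqP -> /eqP ->.
  by rewrite !ffactn0 expr0 divff // oner_neq0.
have n0' : 0 < n%:R :> R by rewrite ltr0n.
rewrite expr_div_n ler_pdivrMr ?ltr0n ?ffact_gt0 // mulrAC ler_pdivlMr ?exprn_gt0 //.
rewrite -!natrX -!natrM ler_nat.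
apply: (@leq_trans (u ^ k * n ^_ k)); last first.
  rewrite leq_mul2r; apply/orP; right.
  by case: (k) => // k'; rewrite leq_exp2r.
elim: (k) => [|k' IH]; first by rewrite !ffactn0.
rewrite !ffactnSr !expnS.
have h : ((u - k') * n <= u * (n - k'))%N by rewrite mulnBl mulnBr leq_sub2l // mulnC leq_mul2l un orbT.
have := leq_mul IH h; nia.
Qed.

(** A weak Stirling bound: [c ^ c] is at most the falling factorial [(2 c) ^_ c], which is the
    factorial of [c] times a central binomial coefficient. *)
Lemma pow_le_fact c : (c ^ c <= c`! * 4 ^ c)%N.
Proof.
have h : ('C(2 * c, c) <= 4 ^ c)%N.
  have := card_draws 'I_(2 * c) c; rewrite card_ord => <-.
  rewrite (_ : 4 = 2 ^ 2)%N // -expnM -[X in (_ <= _ ^ X)%N]card_ord -cardsT -card_powerset.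
  by apply: subset_leq_card; apply/subsetP => A _; rewrite inE subsetT.
have h' j : (j <= c)%N -> (c ^ j <= (2 * c) ^_ j)%N.
  elim: j => // j IH jc; rewrite ffactnSr expnSr leq_mul ?IH ?(ltnW jc) //; lia.
apply: leq_trans (h' c (leqnn c)) _.
by rewrite -bin_ffact mulnC leq_mul2l h orbT.
Qed.

Lemma bin_pow_le N c : ('C(N, c) * c ^ c <= 4 ^ c * N ^ c)%N.
Proof.
apply: (@leq_trans ('C(N, c) * (c`! * 4 ^ c))); first by rewrite leq_mul2l pow_le_fact orbT.
rewrite mulnA bin_ffact mulnC leq_mul2l; apply/orP; right.
by elim: c => // c IH; rewrite ffactnSr expnSr leq_mul // leq_subr.
Qed.

Lemma sum_card_sets (T : finType) (N : nat) (g : nat -> R) : (#|T| < N.+1)%N ->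
  \sum_(A : {set T}) g #|A| = \sum_(c < N.+1) 'C(#|T|, c)%:R * g c.
Proof.
move=> TN; have cA (A : {set T}) : (#|A| < N.+1)%N by apply: leq_ltn_trans (max_card _) TN.
rewrite (partition_big (fun A : {set T} => inord #|A| : 'I_N.+1) predT) //=.
apply: eq_bigr => c _; rewrite -card_draws.
rewrite (eq_bigr (fun=> g c)) => [|A /eqP <-]; last by rewrite inordK.
rewrite sumr_const mulr_natl; congr (_ *+ _); apply: eq_card => A.
by rewrite [RHS]inE -[LHS]/(inord #|A| == c :> 'I_N.+1) -val_eqE /= inordK.
Qed.

Lemma card_cell_preim (U : {set 'I_n}) : (#|[set i | cell i \in U]| <= 2 * #|U|)%N.
Proof.
rewrite mul2n -addnn -[X in (_ <= _ + X)%N](card_imset _ (@rev_ord_inj n)).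
apply: leq_trans (leq_card_setU _ _).1; apply: subset_leq_card.
apply/subsetP => i; rewrite !inE; case: (cellE i) => -> iU; first by rewrite iU.
by apply/orP; right; apply/imsetP; exists (rev_ord i); rewrite ?rev_ordK.
Qed.

Variables (t : nat) (delta Delta : R).
Hypotheses (t3 : (3 <= t)%N) (k0 : (0 < k)%N)
  (delta4 : delta <= 4^-1) (Delta0 : 0 < Delta) (mn : m%:R <= Delta * n%:R).

(** Failure of expansion for [c] constraints touching [v] cells. *)
Definition thin (c v : nat) :=
  2 * v%:R + t%:R * c%:R < (2 * k%:R + 2 * delta) * c%:R :> R.

Definition nonexpanding M : {set instance n k m} :=
  [set I : instance n k m | [exists F : {set 'I_m}, (0 < #|F| <= M)%N &&
     thin #|F| #|\bigcup_(f in F) (cell @: scope_set I f)|]].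

Lemma thin_le c v : thin c v -> (v <= k * c)%N.
Proof.
rewrite /thin -(ler_nat R) natrM => h.
have : 3 <= t%:R :> R by rewrite ler_nat.
move: delta4 (ler0n R c) h; nra.
Qed.

(** The bound [(4 n / v) ^ v] on the binomial cancels [v] of the [k c] factors [v / n]. Thinness
    leaves at least [(t / 2 - delta) c] of them, each at most [x <= 1]. *)
Lemma thin_set_bound c v : thin c v -> (0 < c)%N -> (k * c <= n)%N ->
  'C(n, v)%:R * (2 * v%:R / n%:R) ^+ (k * c) <=
    8 ^+ (k * c) * powR (k%:R * c%:R / n%:R) ((t%:R / 2 - delta) * c%:R) :> R.
Proof.
move=> th c0 kcn; have vk := thin_le th.
have n0 : 0 < n%:R :> R by rewrite ltr0n; apply: leq_trans kcn; rewrite muln_gt0 k0.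
set x := k%:R * c%:R / n%:R.
have x0 : 0 < x by rewrite divr_gt0 // mulr_gt0 ?ltr0n.
have x1 : x <= 1 by rewrite ler_pdivrMr // mul1r -natrM ler_nat.
have vx : v%:R / n%:R <= x by rewrite ler_pM2r ?invr_gt0 // -natrM ler_nat.
have h1 : 'C(n, v)%:R * v%:R ^+ v <= 4 ^+ v * n%:R ^+ v :> R.
  by rewrite -!natrX -!natrM ler_nat bin_pow_le.
have e : (k * c = v + (k * c - v))%N by rewrite subnKC.
set r := (k * c - v)%N in e *.
apply: (@le_trans _ _ (2 ^+ (k * c) * 4 ^+ v * (v%:R / n%:R) ^+ r)).
  have -> : 'C(n, v)%:R * (2 * v%:R / n%:R) ^+ (k * c) =
     2 ^+ (k * c) * ('C(n, v)%:R * v%:R ^+ v) / n%:R ^+ v * (v%:R / n%:R) ^+ r :> R.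
    by rewrite {1}e -mulrA exprMn [(_ / _) ^+ (v + r)]exprD expr_div_n -e; ring.
  apply: ler_wpM2r; first by rewrite exprn_ge0 // divr_ge0.
  rewrite -mulrA; apply: ler_wpM2l; first by rewrite exprn_ge0.
  by rewrite ler_pdivrMr ?exprn_gt0.
have -> : 8 ^+ (k * c) = 2 ^+ (k * c) * 4 ^+ (k * c) :> R.
  by rewrite -exprMn; congr (_ ^+ _); ring.
apply: ler_pM.
- by rewrite mulr_ge0 ?exprn_ge0.
- by rewrite exprn_ge0 // divr_ge0.
- by apply: ler_wpM2l; rewrite ?exprn_ge0 // ler_weXn2l // ler1n.
apply: (@le_trans _ _ (x ^+ r)); first by apply: lerXn2r; rewrite ?nnegrE ?divr_ge0 ?mulr_ge0.
rewrite -powR_mulrn ?(ltW x0) //; apply: ger_powR; first by rewrite x0.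
rewrite /r natrB // natrM; move: th; rewrite /thin; lra.
Qed.

(** Union bound over the families [F] and the sets [U] of cells they touch, grouped by cardinality.
    With [x = k c / n], choosing [F] costs [(4 k Delta / x) ^ c], which uses up one power of [x] per
    constraint. The at most [k c + 1] values of [v] cost [2 ^ (k c)], turning 8 into 16. *)
Lemma pr_nonexpanding M : (k * M <= n)%N ->
  pr (nonexpanding M) <= \sum_(c < M)
    (4 * k%:R * 16 ^+ k * Delta *
       powR (k%:R * c.+1%:R / n%:R) (t%:R / 2 - delta - 1)) ^+ c.+1.
Proof.
move=> kMn.
pose Q (p : {set 'I_m} * {set 'I_n}) := (0 < #|p.1| <= M)%N && thin #|p.1| #|p.2|.
pose E (p : {set 'I_m} * {set 'I_n}) := [set I : instance n k m |
   [forall f in p.1, I f \in within [set i | cell i \in p.2]]].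
have sub : nonexpanding M \subset \bigcup_(p | Q p) E p.
  apply/subsetP => I; rewrite inE => /existsP[F /andP[cF th]].
  apply/bigcupP; exists (F, \bigcup_(f in F) (cell @: scope_set I f)).
    by rewrite /Q cF th.
  rewrite inE; apply/forall_inP => f fF; rewrite inE; apply/forallP => j; rewrite inE.
  by apply/bigcupP; exists f => //; apply: imset_f; apply: imset_f.
apply: le_trans (prS sub) _; apply: le_trans (pr_union _ _) _.
pose g (c v : nat) : R := if thin c v then (2 * v%:R / n%:R) ^+ (k * c) else 0.
pose b (c : nat) : R := 8 ^+ (k * c) * powR (k%:R * c%:R / n%:R) ((t%:R / 2 - delta) * c%:R).
have b0 c : 0 <= b c by rewrite mulr_ge0 ?exprn_ge0 // powR_ge0.
apply: (@le_trans _ _ (\sum_(F : {set 'I_m})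
    if (0 < #|F| <= M)%N then \sum_(U : {set 'I_n}) g #|F| #|U| else 0)).
  rewrite -big_mkcond /= pair_big_dep /= [leRHS]big_mkcond [leLHS]big_mkcond /=.
  apply: ler_sum => -[F U] _; rewrite /Q /= andbT /g.
  case: ifP => [/andP[-> ->]|]; last first.
    by case: ifP => // _ _; case: ifP => // _; rewrite exprn_ge0 // divr_ge0 // mulr_ge0.
  rewrite pr_within exprM lerXn2r ?nnegrE ?divr_ge0 ?exprn_ge0 ?mulr_ge0 ?invr_ge0 //.
  rewrite -natrM; apply: ffact_ratio_le; last exact: card_cell_preim.
  by rewrite -[X in (_ <= X)%N]card_ord max_card.
apply: (@le_trans _ _ (\sum_(F : {set 'I_m})
    if (0 < #|F| <= M)%N then (k * #|F|).+1%:R * b #|F| else 0)).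
  apply: ler_sum => F _; case: ifP => // /andP[c0 cM]; move: #|F| c0 cM => c c0 cM.
  have kcn : (k * c <= n)%N by apply: leq_trans kMn; rewrite leq_mul2l cM orbT.
  rewrite (sum_card_sets (N := n)) ?card_ord //.
  apply: (@le_trans _ _ (\sum_(v < n.+1 | (v < (k * c).+1)%N) b c)).
    rewrite [leRHS]big_mkcond /=; apply: ler_sum => v _; rewrite /g.
    case: ifP => [th|_]; last by rewrite mulr0; case: ifP.
    by rewrite ltnS (thin_le th); apply: thin_set_bound.
  by rewrite -(big_ord_widen _ (fun=> b c)) ?ltnS // sumr_const card_ord mulr_natl.
pose h (c : nat) : R := if (0 < c <= M)%N then (k * c).+1%:R * b c else 0.
(* The range [m + M] covers all cardinalities of [F] as well as all [c <= M], whichever of [m] and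
   [M] is larger. *)
rewrite (sum_card_sets (N := m + M) h) ?card_ord ?ltnS ?leq_addr //.
have -> : \sum_(c < (m + M).+1) 'C(m, c)%:R * h c =
    \sum_(c < (m + M).+1 | (c < M.+1)%N) 'C(m, c)%:R * h c.
  rewrite [RHS]big_mkcond /=; apply: eq_bigr => c _; rewrite /h ltnS.
  by case: (leqP c M) => //; rewrite andbF mulr0.
rewrite -(big_ord_widen _ (fun c => 'C(m, c)%:R * h c)) ?ltnS ?leq_addl //.
rewrite big_ord_recl /= {1}/h /= mulr0 add0r; apply: ler_sum => c _.
rewrite /bump /= add1n /h /= ltn_ord.
have kcn : (k * c.+1 <= n)%N by apply: leq_trans kMn; rewrite leq_mul2l ltn_ord orbT.
move: (c : nat).+1 kcn (ltn0Sn c) => {}c kcn c0.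
have n0 : 0 < n%:R :> R by rewrite ltr0n; apply: leq_trans kcn; rewrite muln_gt0 k0.
rewrite /b; set x := k%:R * c%:R / n%:R.
have x0 : 0 < x by rewrite divr_gt0 // mulr_gt0 ?ltr0n.
have c0' : 0 < c%:R :> R by rewrite ltr0n.
have h1 : 'C(m, c)%:R <= (4 * k%:R * Delta / x) ^+ c :> R.
  have -> : 4 * k%:R * Delta / x = 4 * (Delta * n%:R) / c%:R.
    by rewrite /x; field; rewrite !pnatr_eq0 -!lt0n c0 k0 -(ltr0n R) n0.
  rewrite expr_div_n ler_pdivlMr ?exprn_gt0 //.
  apply: (@le_trans _ _ (4 ^+ c * m%:R ^+ c)).
    by rewrite -!natrX -!natrM ler_nat bin_pow_le.
  by rewrite -exprMn lerXn2r ?nnegrE ?mulr_ge0 ?(ltW Delta0) // ler_pM2l.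
have h2 : (k * c).+1%:R <= 2 ^+ (k * c) :> R by rewrite -natrX ler_nat ltn_expl.
apply: (@le_trans _ _ ((4 * k%:R * Delta / x) ^+ c * (2 ^+ (k * c) *
   (8 ^+ (k * c) * powR x ((t%:R / 2 - delta) * c%:R))))).
  apply: ler_pM => //; first by rewrite mulr_ge0 // mulr_ge0 ?exprn_ge0 ?powR_ge0.
  by apply: ler_wpM2r => //; rewrite mulr_ge0 ?exprn_ge0 ?powR_ge0.
rewrite powRrM powR_mulrn ?powR_ge0 // !exprM -!exprMn lerXn2r ?nnegrE //.
- by rewrite !mulr_ge0 ?exprn_ge0 ?powR_ge0 ?invr_ge0 ?(ltW Delta0) ?(ltW x0).
- by rewrite !mulr_ge0 ?exprn_ge0 ?powR_ge0 ?(ltW Delta0).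
have -> : powR x (t%:R / 2 - delta) = x * powR x (t%:R / 2 - delta - 1).
  rewrite -{2}(powRr1 (ltW x0)) -powRD ?(gt_eqF x0) ?implybT //.
  by congr powR; ring.
have -> : 16 ^+ k = 2 ^+ k * 8 ^+ k :> R by rewrite -exprMn; congr (_ ^+ _); ring.
rewrite le_eqVlt; apply/orP; left; apply/eqP; field.
by rewrite gt_eqF.
Qed.

End Counting.

(** * Clashing and isolated variables *)

Section Moments.

Set Implicit Arguments.
Unset Strict Implicit.
Unset Printing Implicit Defensive.

(** Nonpositive correlations bound the variance of the count by its mean [h], so falling below
    [h / 2] has probability at most [4 / h]. *)
Lemma chebyshev_lower (R : realFieldType) (T J : finType) (L : {set J}) (A : J -> {set T}) (p : R) :
  (forall i, i \in L -> #|A i|%:R = p * #|T|%:R) ->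
  (forall i j, i \in L -> j \in L -> i != j -> #|A i :&: A j|%:R <= p ^+ 2 * #|T|%:R) ->
  0 < #|L|%:R * p ->
  #|[set x | #|[set i in L | x \in A i]|%:R < #|L|%:R * p / 2]|%:R * (#|L|%:R * p) <=
    4 * #|T|%:R.
Proof.
move=> cA cAA hp0; set h := #|L|%:R * p in hp0 *.
set E := [set x | _].
pose N x : R := #|[set i in L | x \in A i]|%:R.
have NE x : N x = \sum_(i in L) (x \in A i)%:R.
  rewrite /N -sum1_card natr_sum big_mkcond [RHS]big_mkcond /=.
  by apply: eq_bigr => i _; rewrite inE; case: (i \in L); case: (x \in A i).
have cE (X : {set T}) : \sum_x (x \in X)%:R = #|X|%:R :> R.
  have e : (\sum_x (x \in X) = #|X|)%N.
    by rewrite -sum1_card [in RHS]big_mkcond /=; apply: eq_bigr => x _; case: (x \in X).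
  by rewrite -natr_sum e.
have s1 : \sum_x N x = h * #|T|%:R.
  rewrite (eq_bigr _ (fun x _ => NE x)) exchange_big /=.
  rewrite (eq_bigr (fun=> p * #|T|%:R)) => [|i iL]; last by rewrite cE cA.
  by rewrite sumr_const -[LHS]mulr_natl mulrA.
have s2 : \sum_x N x ^+ 2 <= (h + h ^+ 2) * #|T|%:R.
  have -> : \sum_x N x ^+ 2 = \sum_(i in L) \sum_(j in L) #|A i :&: A j|%:R.
    transitivity (\sum_x \sum_(i in L) \sum_(j in L) ((x \in A i :&: A j)%:R : R)).
      apply: eq_bigr => x _; rewrite NE expr2 mulr_suml; apply: eq_bigr => i _.
      rewrite mulr_sumr; apply: eq_bigr => j _; rewrite inE -natrM.
      by case: (x \in A i); case: (x \in A j).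
    rewrite exchange_big /=; apply: eq_bigr => i _; rewrite exchange_big /=.
    by apply: eq_bigr => j _; rewrite cE.
  apply: (@le_trans _ _ (\sum_(i in L) (p * #|T|%:R + #|L|%:R * (p ^+ 2 * #|T|%:R)))).
    apply: ler_sum => i iL; rewrite (bigD1 i) //= setIid cA // lerD2l.
    apply: (@le_trans _ _ (\sum_(j in L | j != i) p ^+ 2 * #|T|%:R)).
      by apply: ler_sum => j /andP[jL ji]; apply: cAA; rewrite // eq_sym.
    rewrite [leRHS]mulr_natl -[leRHS]sumr_const [leRHS](bigD1 i) //=.
    by rewrite lerDr mulr_ge0 ?sqr_ge0.
  by rewrite sumr_const -[leLHS]mulr_natl /h le_eqVlt; apply/orP; left; apply/eqP; ring.
have s3 : #|E|%:R * (h ^+ 2 / 4) <= \sum_x (N x - h) ^+ 2.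
  rewrite -cE mulr_suml; apply: ler_sum => x _; rewrite inE -/(N x).
  case: ltP => [lt|_]; last by rewrite mul0r sqr_ge0.
  by rewrite mul1r; move: lt hp0; nra.
have s4 : \sum_x (N x - h) ^+ 2 = \sum_x N x ^+ 2 - 2 * h * \sum_x N x + h ^+ 2 * #|T|%:R.
  have -> : h ^+ 2 * #|T|%:R = \sum_(x : T) h ^+ 2 by rewrite sumr_const mulr_natr.
  rewrite mulr_sumr -sumrB -big_split /=; apply: eq_bigr => x _; ring.
have : #|E|%:R * (h ^+ 2 / 4) <= h * #|T|%:R.
  by apply: (le_trans s3); rewrite s4 s1; move: s2; nra.
rewrite -(ler_pM2l hp0) => le.
rewrite -(ler_pM2l hp0); move: le hp0; set e := #|E|%:R; set u := #|T|%:R => le hp0.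
have : h * (e * h) <= h * (4 * u).
  suff : h * (h * (e * h)) <= h * (h * (4 * u)) by rewrite ler_pM2l.
  by move: le; lra.
by [].
Qed.

(** Follows from [1 <= (1 - x) (1 + 2 x)] on this range and [1 + 2 x <= expR (2 x)]. *)
Lemma exp_lower_bound (R : realType) (x : R) : 0 <= x <= 1 / 2 -> expR (- (2 * x)) <= 1 - x.
Proof.
move=> /andP[x0 x1]; rewrite expRN.
have h : 1 + 2 * x <= expR (2 * x) by apply: expR_ge1Dx.
have h0 : 0 < expR (2 * x) by apply: expR_gt0.
rewrite -[leLHS]mul1r ler_pdivrMr //.
apply: (@le_trans _ _ ((1 - x) * (1 + 2 * x))); first by nra.
by rewrite ler_wpM2l //; lra.
Qed.

Variables (R : realType) (n k m : nat).
Hypotheses (kn : (k <= n)%N) (k0 : (0 < k)%N).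

Definition clashing : {set constraint n k} :=
  [set C : constraint n k | [exists j, exists l,
     (sval C.1 j != rev_ord (sval C.1 j)) && (sval C.1 l == rev_ord (sval C.1 j))]].

(** The variable at position [l] is determined by the one at [j], so erasing position [l] is
    injective. *)
Lemma card_clash (j l : 'I_k) : j != l ->
  (#|[set v : scope n k | sval v l == rev_ord (sval v j)]| <= n ^_ k.-1)%N.
Proof.
move=> jl; rewrite -[X in (X ^_ _)%N]card_ord -[X in (_ ^_ X)%N]card_ord -card_inj_ffuns.
pose r (v : scope n k) : {ffun 'I_k.-1 -> 'I_n} := [ffun i => sval v (lift l i)].
rewrite -(@card_in_imset _ _ r).
  apply: subset_leq_card; apply/subsetP => g /imsetP[v _ ->]; rewrite inE.
  apply/injectiveP => a b; rewrite !ffunE => e; apply: (@lift_inj _ l).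
  exact: (injectiveP _ (valP v)) _ _ e.
move=> v v'; rewrite !inE => /eqP e /eqP e' /ffunP h; apply: val_inj; apply/ffunP => i.
have hl a : sval v (lift l a) = sval v' (lift l a) by have := h a; rewrite !ffunE.
case: (unliftP l i) => [a ->|->]; first exact: hl.
case: (unliftP l j) => [a ja|jl']; last by rewrite jl' eqxx in jl.
by rewrite -[LHS]/(sval v l) -[RHS]/(sval v' l) e e' ja hl.
Qed.

(** Union bound over the [k ^ 2] pairs of positions, with [n ^_ k = n ^_ (k - 1) (n - k + 1)]. *)
Lemma clashing_ratio :
  #|clashing|%:R / #|{: constraint n k}|%:R <= k%:R ^+ 2 / (n - k).+1%:R :> R.
Proof.
have c : (#|clashing| <= k ^ 2 * (n ^_ k.-1 * 2 ^ k))%N.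
  pose S (p : 'I_k * 'I_k) : {set constraint n k} := [set C : constraint n k |
     (p.1 != p.2) && (sval C.1 p.2 == rev_ord (sval C.1 p.1))].
  apply: (@leq_trans #|\bigcup_p S p|).
    apply: subset_leq_card; apply/subsetP => C; rewrite inE => /existsP[j /existsP[l /andP[ne e]]].
    apply/bigcupP; exists (j, l) => //; rewrite inE e andbT /=.
    by apply: contraNneq ne => jl; rewrite {1}jl; exact: e.
  apply: (@leq_trans (\sum_(p : 'I_k * 'I_k) n ^_ k.-1 * 2 ^ k)); last first.
    by rewrite sum_nat_const card_prod card_ord.
  apply: (@leq_trans (\sum_(p : 'I_k * 'I_k) #|S p|)).
    elim/big_rec2: _ => [|p a b _ h]; first by rewrite cards0.
    by apply: leq_trans (leq_card_setU _ _).1 _; rewrite leq_add2l.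
  apply: leq_sum => -[j l] _; case: (eqVneq j l) => [e|ne].
    by rewrite (_ : S _ = set0) ?cards0 //; apply/setP => C; rewrite !inE /= e eqxx.
  have -> : #|S (j, l)| = (#|[set v : scope n k | sval v l == rev_ord (sval v j)]| *
     #|[set: {ffun 'I_k -> bool}]|)%N.
    by rewrite -cardsX; apply: eq_card => -[v e]; rewrite !inE /= ne andbT.
  rewrite cardsT card_ffun card_bool card_ord leq_mul2r; apply/orP; right.
  exact: card_clash.
have nk0 : 0 < (n - k).+1%:R :> R by rewrite ltr0n.
have C0 : 0 < #|{: constraint n k}|%:R :> R.
  by rewrite card_constraint ltr0n muln_gt0 ffact_gt0 kn expn_gt0.
rewrite ler_pdivrMr // mulrAC ler_pdivlMr // -!natrX -!natrM ler_nat card_constraint.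
have e : (n ^_ k = n ^_ k.-1 * (n - k).+1)%N.
  by rewrite -{1}(prednK k0) ffactnSr; congr (_ * _)%N; lia.
rewrite e; apply: (leq_trans (leq_mul c (leqnn _))).
by rewrite -!mulnA leq_mul2l leq_mul2l [((n - k).+1 * _)%N]mulnC leqnn !orbT.
Qed.

Definition clashes (I : instance n k m) := [set f | I f \in clashing].

(** Markov's inequality for the number of clashing constraints. *)
Lemma pr_clashes (s : nat) : (0 < s)%N ->
  pr R [set I : instance n k m | (s <= #|clashes I|)%N] <= m%:R * (k%:R ^+ 2 / (n - k).+1%:R) / s%:R.
Proof.
move=> s0; rewrite ler_pdivlMr ?ltr0n //.
have T0 : 0 < #|{: instance n k m}|%:R :> R by rewrite ltr0n instance_gt0.
rewrite /pr mulrAC ler_pdivrMr //.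
apply: (@le_trans _ _ (\sum_(I : instance n k m) #|clashes I|%:R)).
  rewrite -natrM -natr_sum ler_nat -sum_nat_const big_mkcond /=.
  by apply: leq_sum => I _; rewrite inE; case: ifP.
have -> : \sum_(I : instance n k m) #|clashes I|%:R =
   \sum_(f < m) #|[set I : instance n k m | [forall f' in [set f], I f' \in clashing]]|%:R :> R.
  rewrite -!natr_sum; congr _%:R.
  under eq_bigr => I _ do rewrite -sum1_card big_mkcond /=.
  rewrite exchange_big /=; apply: eq_bigr => f _.
  rewrite -sum1_card [RHS]big_mkcond /=; apply: eq_bigr => I _.
  have -> : (f \in clashes I) = (I f \in clashing) by rewrite in_set.
  rewrite [X in _ = (if X then _ else _)]in_set.
  congr (if _ then _ else _); apply/idP/forall_inP => [h f'|]; first by rewrite in_set1 => /eqP ->.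
  by apply; rewrite in_set1.
rewrite -mulrA -[X in X%:R * _]card_ord mulr_natl -[leRHS]sumr_const; apply: ler_sum => f _.
rewrite -ler_pdivrMr // -/(pr R _) pr_forall // cards1 expr1.
exact: clashing_ratio.
Qed.

(** The 1 accounts for a middle variable, [k] for the scope of each clashing constraint. *)
Lemma card_lonely (I : instance n k m) : (#|lonely I| <= 1 + k * #|clashes I|)%N.
Proof.
have sub : lonely I \subset [set i : 'I_n | i == rev_ord i] :|: \bigcup_(f in clashes I) scope_set I f.
  apply/subsetP => i; rewrite in_setU !inE; case: (boolP (i == rev_ord i)) => //= ne.
  move=> /existsP[f /andP[/imsetP[j _ ej] /imsetP[l _ el]]].
  apply/bigcupP; exists f; last by rewrite ej; apply: imset_f.
  rewrite inE inE; apply/existsP; exists j; apply/existsP; exists l.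
  by rewrite -ej -el ne eqxx.
apply: leq_trans (subset_leq_card sub) _; apply: leq_trans (leq_card_setU _ _).1 _.
apply: leq_add.
  apply/card_le1_eqP => i j; rewrite !inE => /eqP/(congr1 val) /= ei /eqP/(congr1 val) /= ej.
  by apply: ord_inj; move: (ltn_ord i) (ltn_ord j) ei ej; clear; lia.
rewrite mulnC -sum_nat_const; elim/big_rec2: _ => [|f a b _ h]; first by rewrite cards0.
apply: leq_trans (leq_card_setU _ _).1 _; apply: leq_add h.
by apply: leq_trans (leq_imset_card _ _) _; rewrite card_ord.
Qed.

(** * Pairs of variables that no constraint touches *)

Definition low := [set i : 'I_n | (i < rev_ord i)%N].

Lemma card_low : (n <= 2 * #|low| + 1)%N.
Proof.
have : (#|[set: 'I_n]| <= #|low :|: (@rev_ord n @: low :|: [set i : 'I_n | i == rev_ord i])|)%N.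
  apply: subset_leq_card; apply/subsetP => i _; rewrite in_setU in_setU.
  case: (boolP (i \in low)) => //=; rewrite inE => nl; apply/orP.
  case: (eqVneq i (rev_ord i)) => [e|ne]; [right|left]; first by rewrite inE -e.
  apply/imsetP; exists (rev_ord i); rewrite ?rev_ordK //.
  by rewrite inE rev_ordK rev_neq_lt.
rewrite cardsT card_ord => /leq_trans; apply.
apply: leq_trans (leq_card_setU _ _).1 _; rewrite mul2n -addnn -addnA leq_add2l.
apply: leq_trans (leq_card_setU _ _).1 _; apply: leq_add; first exact: leq_imset_card.
apply/card_le1_eqP => i j; rewrite !inE => /eqP/(congr1 val) /= ei /eqP/(congr1 val) /= ej.
by apply: ord_inj; move: (ltn_ord i) (ltn_ord j) ei ej; clear; lia.
Qed.

Definition avoiding (i : 'I_n) : {set instance n k m} :=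
  [set I : instance n k m | [forall f in [set: 'I_m], I f \in within k (~: [set i; rev_ord i])]].

Lemma isolated_avoiding (I : instance n k m) :
  [set i in low | I \in avoiding i] \subset isolated I.
Proof.
apply/subsetP => i; rewrite !inE => /andP[lt /forall_inP h].
apply/andP; split; first by apply: contraTneq lt => {1}->; rewrite ltnn.
apply/forallP => f; have := h f (in_setT _); rewrite inE => /forallP hf.
by apply/andP; split; apply/negP => /imsetP[j _ e]; have := hf j; rewrite !inE -e eqxx ?orbT.
Qed.

(** The probability that one random constraint misses a given pair of distinct partners. *)
Definition avoid_ratio : R := ((n - 2) ^_ k)%:R / (n ^_ k)%:R.

Lemma card_compl2 i : i \in low -> #|~: [set i; rev_ord i]| = (n - 2)%N.
Proof.
rewrite inE => lt; have := cardsC [set i; rev_ord i]; rewrite card_ord cards2.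
have -> : i != rev_ord i by apply: contraTneq lt => {1}->; rewrite ltnn.
by move: #|_| => c /=; lia.
Qed.

Lemma card_avoiding i : i \in low ->
  #|avoiding i|%:R = avoid_ratio ^+ m * #|{: instance n k m}|%:R.
Proof.
move=> il; have := pr_within R kn [set: 'I_m] (~: [set i; rev_ord i]).
rewrite card_compl2 // cardsT card_ord /pr => <-.
by rewrite divfK // instance_neq0.
Qed.

(** Makes the avoidance of two different pairs nonpositively correlated, as the second moment bound
    requires. *)
Lemma ffact_log_concave : (((n - 4) ^_ k) * (n ^_ k) <= (n - 2) ^_ k * (n - 2) ^_ k)%N.
Proof.
elim: (k) => [|k' IH]; first by rewrite !ffactn0.
rewrite !ffactnSr.
have h : ((n - 4 - k') * (n - k') <= (n - 2 - k') * (n - 2 - k'))%N by nia.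
have := leq_mul IH h; nia.
Qed.

Lemma card_avoiding2 i j : i \in low -> j \in low -> i != j ->
  #|avoiding i :&: avoiding j|%:R <= (avoid_ratio ^+ m) ^+ 2 * #|{: instance n k m}|%:R.
Proof.
move=> il jl ij; have T0 : 0 < #|{: instance n k m}|%:R :> R by rewrite ltr0n instance_gt0.
pose U := ~: ([set i; rev_ord i] :|: [set j; rev_ord j]).
have cU : #|U| = (n - 4)%N.
  have := cardsC ([set i; rev_ord i] :|: [set j; rev_ord j]); rewrite card_ord -/U.
  move: il jl; rewrite !inE => il jl.
  have -> : #|[set i; rev_ord i] :|: [set j; rev_ord j]| = 4%N.
    have /eqP -> : #|[set i; rev_ord i] :|: [set j; rev_ord j]| ==
        (#|[set i; rev_ord i]| + #|[set j; rev_ord j]|)%N.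
      rewrite (leq_card_setU _ _).2 disjoints_subset; apply/subsetP => x.
      rewrite !inE => /orP[] /eqP ->; apply/norP; split; rewrite ?(inj_eq rev_ord_inj) //.
        apply: contraTneq il => ->; rewrite rev_ordK; apply/negP => lt.
        by have := ltn_trans lt jl; rewrite ltnn.
      apply: contraTneq jl => <-; rewrite rev_ordK; apply/negP => lt.
      by have := ltn_trans lt il; rewrite ltnn.
    rewrite !cards2.
    have -> : i != rev_ord i by apply: contraTneq il => {1}->; rewrite ltnn.
    by have -> : j != rev_ord j by apply: contraTneq jl => {1}->; rewrite ltnn.
  by move: #|U| => c; lia.
have -> : avoiding i :&: avoiding j =
   [set I : instance n k m | [forall f in [set: 'I_m], I f \in within k U]].
  apply/setP => I; rewrite !inE; apply/andP/forall_inP => [[/forall_inP h /forall_inP h'] f _|h].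
    have := h f (in_setT _); have := h' f (in_setT _); rewrite !inE => /forallP a /forallP b.
    by apply/forallP => l; rewrite /U setCU inE a b.
  split; apply/forall_inP => f _; have := h f (in_setT _); rewrite !inE => /forallP a;
  by apply/forallP => l; have := a l; rewrite /U setCU inE => /andP[].
rewrite -ler_pdivrMr // -/(pr R _) pr_within // cU cardsT card_ord -exprM mulnC exprM.
apply: lerXn2r; rewrite ?nnegrE ?exprn_ge0 ?divr_ge0 //.
have F0 : 0 < (n ^_ k)%:R :> R by rewrite ltr0n ffact_gt0.
rewrite /avoid_ratio expr_div_n ler_pdivrMr // mulrAC ler_pdivlMr ?exprn_gt0 //.
rewrite !expr2 mulrA; apply: ler_wpM2r => //.
by rewrite -!natrM ler_nat ffact_log_concave.
Qed.

(** Expanding [n ^_ (k + 2)] from both ends shows that the ratio is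
    [(n - k) (n - k - 1) / (n (n - 1))]. *)
Lemma avoid_ratio_ge : (4 * k <= n)%N -> 1 - 4 * k%:R / n%:R <= avoid_ratio.
Proof.
move=> k4; have n2 : (2 <= n)%N by lia.
have e : ((n - 2) ^_ k * (n * (n - 1)) = n ^_ k * ((n - k) * (n - k - 1)))%N.
  have h : (n ^_ k.+2 = n * ((n - 1) * (n - 2) ^_ k))%N.
    by rewrite ffactnS -subn1 ffactnS; congr (_ * (_ * _ ^_ _))%N; lia.
  have h' : (n ^_ k.+2 = n ^_ k * (n - k) * (n - k.+1))%N by rewrite !ffactnSr.
  have e1 : (n - k - 1 = n - k.+1)%N by lia.
  by rewrite e1 [RHS]mulnA -h' h; lia.
have F0 : 0 < (n ^_ k)%:R :> R by rewrite ltr0n ffact_gt0.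
have n0 : 0 < n%:R :> R by rewrite ltr0n; lia.
rewrite ler_pdivlMr //.
move/(congr1 (GRing.natmul (1 : R))): e; rewrite !natrM !natrB //; try by lia.
have n2' : 2 <= n%:R :> R by rewrite ler_nat.
have k1' : 1 <= k%:R :> R by rewrite ler1n.
have k4' : 4 * k%:R <= n%:R :> R by rewrite -natrM ler_nat.
move: n0 F0; set x := n%:R; set K := k%:R; set F := (n ^_ k)%:R; set G := ((n - 2) ^_ k)%:R.
rewrite -/x -/K in n2' k1' k4' *.
move=> x0 F0 e.
have p0 : 0 < x * (x - 1) by rewrite mulr_gt0 //; lra.
rewrite -(ler_pM2r p0) e.
have -> : (1 - 4 * K / x) * F * (x * (x - 1)) = F * ((x - 4 * K) * (x - 1)).
  by field; rewrite gt_eqF.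
rewrite ler_pM2l //; nra.
Qed.

(** The bound is independent of [n], so linearly many isolated variables are expected. *)
Lemma avoid_pow_ge (Delta : R) : (8 * k <= n)%N -> 0 < Delta -> m%:R <= Delta * n%:R ->
  expR (- (8 * k%:R * Delta)) <= avoid_ratio ^+ m.
Proof.
move=> k8 D0 mD; have n0 : 0 < n%:R :> R by rewrite ltr0n; lia.
have k8' : 8 * k%:R <= n%:R :> R by rewrite -natrM ler_nat.
apply: (@le_trans _ _ (expR (- (2 * (4 * k%:R / n%:R))) ^+ m)).
  rewrite -expRM_natl ler_expR mulrN lerN2.
  have -> : 8 * k%:R * Delta = Delta * n%:R * (2 * (4 * k%:R / n%:R)).
    by field; rewrite gt_eqF.
  by apply: ler_wpM2r mD; rewrite !mulr_ge0 ?invr_ge0 ?(ltW n0).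
apply: lerXn2r; rewrite ?nnegrE ?expR_ge0 ?divr_ge0 //.
apply: le_trans (avoid_ratio_ge _); last by lia.
apply: exp_lower_bound; rewrite divr_ge0 ?mulr_ge0 //= ler_pdivrMr //; lra.
Qed.

Lemma pr_isolated (rho : R) : 0 < rho -> rho <= avoid_ratio ^+ m -> (2 <= n)%N ->
  pr R [set I : instance n k m | #|isolated I|%:R < n%:R * rho / 8] <= 16 / (n%:R * rho).
Proof.
move=> r0 rp n2; have T0 : 0 < #|{: instance n k m}|%:R :> R by rewrite ltr0n instance_gt0.
set p := avoid_ratio ^+ m in rp.
have n2' : 2 <= n%:R :> R by rewrite ler_nat.
have l4 : n%:R <= 4 * #|low|%:R :> R.
  by rewrite -natrM ler_nat; move: card_low n2; clear; move: #|low| => c; lia.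
have h0 : n%:R * rho / 4 <= #|low|%:R * p.
  have : n%:R / 4 * rho <= #|low|%:R * p.
    apply: ler_pM => //; [by rewrite divr_ge0|exact: ltW|lra].
  by lra.
have nr0 : 0 < n%:R * rho by rewrite mulr_gt0 // (lt_le_trans _ n2').
have hp0 : 0 < #|low|%:R * p by lra.
have := chebyshev_lower card_avoiding card_avoiding2 hp0; rewrite -/p.
set E := [set x | _] => le.
apply: (@le_trans _ _ (#|E|%:R / #|{: instance n k m}|%:R)).
  rewrite ler_wpM2r ?invr_ge0 // ler_nat subset_leq_card //.
  apply/subsetP => I; rewrite !inE => lt.
  have := subset_leq_card (isolated_avoiding I); rewrite -(ler_nat R) => le'.
  apply: le_lt_trans le' _; move: lt h0; move: (#|low|%:R * p) => h; lra.
rewrite ler_pdivrMr // mulrAC ler_pdivlMr //.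
apply: (@le_trans _ _ (#|E|%:R * (4 * (#|low|%:R * p)))).
  by apply: ler_wpM2l => //; lra.
by move: le; lra.
Qed.

End Moments.

(** * Asymptotics *)

Section Asymptotics.

Set Implicit Arguments.
Unset Strict Implicit.
Unset Printing Implicit Defensive.

Variable R : realType.

Lemma eventually_ge (C : R) : exists N : nat, forall n, (N <= n)%N -> C <= n%:R.
Proof.
exists (Num.truncn C).+1 => n le; apply/ltW/(lt_le_trans (truncnS_gt C)).
by rewrite ler_nat.
Qed.

Lemma powR_expn4 (y : R) : 0 <= y -> powR (y ^+ 4) (4^-1) = y.
Proof.
move=> y0; rewrite -powR_mulrn // -powRrM divff ?powRr1 //.
by rewrite pnatr_eq0.
Qed.

Lemma sum_half_le1 M : \sum_(c < M) (2^-1 : R) ^+ c.+1 <= 1.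
Proof.
have -> : \sum_(c < M) (2^-1 : R) ^+ c.+1 = 1 - 2^-1 ^+ M.
  elim: M => [|M IH]; first by rewrite big_ord0 expr0 subrr.
  by rewrite big_ord_recr /= IH exprS; lra.
by rewrite gerBl exprn_ge0 ?invr_ge0.
Qed.

(** The majorant is [eps * 2^-1 ^+ c.+1]. From index [s] on, terms are at most [4^-1 ^+ c.+1], the
    square of a power of one half that is itself at most [eps]; the earlier terms are small by
    assumption. *)
Lemma series_small (x : nat -> R) (M s : nat) (eps : R) :
  (forall c, (c < M)%N -> 0 <= x c <= 4^-1) ->
  2^-1 ^+ s <= eps ->
  (forall c, (c < M)%N -> (c < s)%N -> x c <= eps * 2^-1 ^+ s) ->
  \sum_(c < M) x c ^+ c.+1 <= eps.
Proof.
move=> x4 se xs.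
have e0 : 0 <= eps by apply: le_trans se; rewrite exprn_ge0 ?invr_ge0.
apply: (@le_trans _ _ (\sum_(c < M) eps * 2^-1 ^+ c.+1)).
  apply: ler_sum => c _; have /andP[x0 xc] := x4 c (ltn_ord c).
  case: (ltnP c s) => cs.
    apply: (@le_trans _ _ (x c)).
      by rewrite exprS ler_piMr // exprn_ile1 //; lra.
    apply: le_trans (xs c (ltn_ord c) cs) _; apply: ler_wpM2l => //.
    by apply: ler_wiXn2l => //; lra.
  apply: (@le_trans _ _ (2^-1 ^+ c.+1 * 2^-1 ^+ c.+1)).
    by rewrite -exprMn; apply: lerXn2r; rewrite ?nnegrE //; lra.
  apply: ler_wpM2r; first by rewrite exprn_ge0 ?invr_ge0.
  by apply: le_trans se; apply: ler_wiXn2l; [lra|lra|exact: leqW].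
by rewrite -mulr_sumr ler_piMr // sum_half_le1.
Qed.

Lemma half_pow_small (eps : R) : 0 < eps -> exists s : nat, 2^-1 ^+ s <= eps.
Proof.
move=> e0; have [N hN] := eventually_ge eps^-1; exists N.
have := hN N (leqnn N) => le.
rewrite -[leRHS]invrK exprVn lef_pV2 ?posrE ?exprn_gt0 ?invr_gt0 //.
by apply: le_trans le _; rewrite -natrX ler_nat ltnW // ltn_expl.
Qed.

Lemma ln2_gt0 : 0 < ln 2 :> R.
Proof. by apply: ln_gt0; rewrite ltr1n. Qed.

(** * Calibration of the constants *)

Section Density.

Variables (k t : nat) (Delta : R).
Hypotheses (k0 : (0 < k)%N) (t3 : (3 <= t)%N) (Delta0 : 0 < Delta).

Let D := Num.max 2 Delta.
Let C2 : R := 4 * k%:R * 16 ^+ k.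
(** Chosen so that [C2 * (2 * kappa) = 4^-1]. The fourth power in [c0] compensates for exponents
    only known to be at least [4^-1]. *)
Let kappa := (8 * C2)^-1.
Let c0 := kappa ^+ 4 / k%:R.
Let q : R := 2 / (t%:R - 2).

Definition gap : R := ln 2 / (4 * ln D).
Definition expansion_size (n : nat) := Num.truncn (c0 * n%:R / powR D q).

Lemma D_ge2 : 2 <= D. Proof. by rewrite /D le_max lexx. Qed.

Lemma D_gt0 : 0 < D. Proof. exact: lt_le_trans D_ge2. Qed.

Lemma ln2_le_lnD : ln 2 <= ln D.
Proof. by rewrite ler_ln ?posrE ?D_gt0 // D_ge2. Qed.

Lemma lnD_gt0 : 0 < ln D.
Proof. exact: lt_le_trans ln2_gt0 ln2_le_lnD. Qed.

Lemma gap_gt0 : 0 < gap.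
Proof. by rewrite divr_gt0 ?ln2_gt0 // mulr_gt0 // lnD_gt0. Qed.

Lemma gap_le : gap <= 4^-1.
Proof.
rewrite /gap ler_pdivrMr ?mulr_gt0 ?lnD_gt0 //.
by have := ln2_le_lnD; lra.
Qed.

Lemma t_ge3 : 3 <= t%:R :> R. Proof. by rewrite ler_nat. Qed.

Lemma C2_ge1 : 1 <= C2.
Proof.
rewrite /C2 -natrX -!natrM ler1n !muln_gt0 k0 expn_gt0.
by [].
Qed.

Lemma kappa_gt0 : 0 < kappa.
Proof. by have := C2_ge1; rewrite /kappa invr_gt0; lra. Qed.

Lemma kappa_le1 : kappa <= 1.
Proof.
have C8 : 1 <= 8 * C2 by have := C2_ge1; lra.
by rewrite /kappa invf_le1 // (lt_le_trans _ C8).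
Qed.

Lemma c0_gt0 : 0 < c0.
Proof. by rewrite divr_gt0 ?exprn_gt0 ?kappa_gt0 // ltr0n. Qed.

Lemma q_ge0 : 0 <= q.
Proof. by rewrite divr_ge0 //; have := t_ge3; lra. Qed.

Lemma Dq_ge1 : 1 <= powR D q.
Proof.
rewrite -(powRr0 D); apply: ler_powR; last exact: q_ge0.
by have := D_ge2; lra.
Qed.

(* The gap [delta ~ 1 / ln D] is what makes [D `^ delta] bounded, so that the
   loss in the exponent costs only a constant factor. *)
Lemma density_bound (x : R) : 0 <= x -> x <= kappa ^+ 4 / powR D q ->
  C2 * Delta * powR x (t%:R / 2 - gap - 1) <= 4^-1.
Proof.
move=> x0 xle; set g := _ - 1.
have g4 : 4^-1 <= g by rewrite /g; have := t_ge3; have := gap_le; lra.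
have g0 : 0 <= g by lra.
have Dq0 : 0 < powR D q by apply: powR_gt0; exact: D_gt0.
have k0' := ltW kappa_gt0.
have h1 : powR x g <= kappa * (2 / D).
  apply: (@le_trans _ _ (powR (kappa ^+ 4 / powR D q) g)).
    by apply: ge0_ler_powR; rewrite ?nnegrE // divr_ge0 ?exprn_ge0 // ltW.
  have kk : 0 <= kappa ^+ 4 by apply: exprn_ge0.
  have Di : 0 <= (powR D q)^-1 by rewrite invr_ge0 ltW.
  rewrite powRM //; apply: ler_pM; rewrite ?powR_ge0 //.
    rewrite -{2}(powR_expn4 k0'); apply: ger_powR => //.
    by rewrite exprn_gt0 ?kappa_gt0 //= exprn_ile1 // kappa_le1.
  rewrite -powRN -powRrM.
  (* The choice of [q] turns the main part of [g] into the power -1 of [D], which cancels [Delta];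
     the remaining power [gap * q] of [D] is at most 2 by the choice of [gap]. *)
  have -> : - q * g = -1 + gap * (2 / (t%:R - 2)).
    by rewrite /q /g; field; rewrite gt_eqF //; have := t_ge3; lra.
  rewrite powRD; last by rewrite (gt_eqF D_gt0) implybT.
  rewrite powR_inv1 ?(ltW D_gt0) // mulrC; apply: ler_wpM2r.
    by rewrite invr_ge0 (ltW D_gt0).
  rewrite /powR gt_eqF ?D_gt0 //.
  apply: (@le_trans _ _ (expR (ln 2))); last by rewrite lnK // posrE.
  rewrite ler_expR.
  have -> : gap * (2 / (t%:R - 2)) * ln D = ln 2 * (2 / (4 * (t%:R - 2))).
    rewrite /gap; field; rewrite !gt_eqF ?lnD_gt0 //; have := t_ge3; lra.
  rewrite ler_piMr ?(ltW ln2_gt0) // ler_pdivrMr; have := t_ge3; lra.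
apply: (@le_trans _ _ (C2 * D * (kappa * (2 / D)))).
  apply: ler_pM => //; first by rewrite mulr_ge0 ?(ltW Delta0) //; have := C2_ge1; lra.
    exact: powR_ge0.
  by apply: ler_wpM2l; [have := C2_ge1; lra|rewrite /D le_max lexx orbT].
rewrite /kappa le_eqVlt; apply/orP; left; apply/eqP; field.
by rewrite !gt_eqF ?D_gt0 //; have := C2_ge1; lra.
Qed.

Lemma expansion_size_le n : (expansion_size n)%:R <= c0 * n%:R / powR D q :> R.
Proof.
by rewrite truncn_le divr_ge0 ?powR_ge0 // mulr_ge0 // ltW // c0_gt0.
Qed.

Lemma k_expansion_size_le n : (k * expansion_size n <= n)%N.
Proof.
rewrite -(ler_nat R) natrM.
have k0' : 0 < k%:R :> R by rewrite ltr0n.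
have Dq0 : 0 < powR D q by apply: powR_gt0; exact: D_gt0.
apply: (@le_trans _ _ (kappa ^+ 4 * n%:R / powR D q)).
  apply: (@le_trans _ _ (k%:R * (c0 * n%:R / powR D q))).
    by rewrite ler_pM2l // expansion_size_le.
  by rewrite le_eqVlt; apply/orP; left; apply/eqP; rewrite /c0; field; rewrite !gt_eqF.
rewrite ler_pdivrMr // [leRHS]mulrC; apply: ler_wpM2r => //.
by apply: le_trans Dq_ge1; rewrite exprn_ile1 ?kappa_le1 // ltW // kappa_gt0.
Qed.

(** [density_bound] puts every base below [4^-1], and for large [n] the first [s] bases are as small
    as desired because [k * c.+1 / n] tends to 0. *)
Lemma nonexpanding_series (eps : R) : 0 < eps -> exists N, forall n, (N <= n)%N ->
  \sum_(c < expansion_size n)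
    (C2 * Delta * powR (k%:R * c.+1%:R / n%:R) (t%:R / 2 - gap - 1)) ^+ c.+1 <= eps.
Proof.
move=> e0; have [s hs] := half_pow_small e0.
have k0' : 0 < k%:R :> R by rewrite ltr0n.
have Dq0 : 0 < powR D q by apply: powR_gt0; exact: D_gt0.
have CD0 : 0 < C2 * Delta by rewrite mulr_gt0 //; have := C2_ge1; lra.
set eta := eps * 2^-1 ^+ s; have eta0 : 0 < eta by rewrite mulr_gt0 // exprn_gt0 // invr_gt0.
pose y := Num.min 1 (eta / (C2 * Delta)).
have y0 : 0 < y by rewrite lt_min ltr01 divr_gt0.
have [N hN] := eventually_ge (k%:R * s%:R / y ^+ 4); exists N.+1 => n nN.
have n0 : 0 < n%:R :> R by rewrite ltr0n; exact: leq_ltn_trans nN.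
apply: (@series_small (fun c => C2 * Delta *
   powR (k%:R * c.+1%:R / n%:R) (t%:R / 2 - gap - 1)) _ s) => // [c cM|c cM cs].
  apply/andP; split; first by rewrite mulr_ge0 ?powR_ge0 // ltW.
  apply: density_bound; first by rewrite divr_ge0 // mulr_ge0.
  rewrite ler_pdivrMr //; apply: (@le_trans _ _ (k%:R * (c0 * n%:R / powR D q))).
    rewrite ler_pM2l //; apply: le_trans (expansion_size_le n).
    by rewrite ler_nat.
  by rewrite le_eqVlt; apply/orP; left; apply/eqP; rewrite /c0; field; rewrite !gt_eqF.
have xy : k%:R * c.+1%:R / n%:R <= y ^+ 4.
  rewrite ler_pdivrMr // [leRHS]mulrC -ler_pdivrMr ?exprn_gt0 //.
  apply: le_trans (hN n (ltnW nN)); apply: ler_wpM2r; first by rewrite invr_ge0 exprn_ge0 // ltW.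
  by rewrite ler_pM2l // ler_nat.
have g4 : 4^-1 <= t%:R / 2 - gap - 1 by have := t_ge3; have := gap_le; lra.
rewrite mulrC -ler_pdivlMr //; apply: (@le_trans _ _ y); last by rewrite /y ge_min lexx orbT.
rewrite -[leRHS](powR_expn4 (ltW y0)).
apply: (@le_trans _ _ (powR (y ^+ 4) (t%:R / 2 - gap - 1))).
  apply: ge0_ler_powR; rewrite ?nnegrE ?exprn_ge0 ?divr_ge0 ?mulr_ge0 ?(ltW y0) //; lra.
apply: ger_powR => //; rewrite exprn_gt0 //= exprn_ile1 ?(ltW y0) //.
by rewrite /y ge_min lexx.
Qed.

(** Depends on [k] alone, so it can be fixed before the predicate and [Delta]. The 16 is twice the 8
    arising from [gap / 2]; the spare factor absorbs rounding and the subtraction of [k]. *)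
Definition rate_constant : R := ln 2 / 16 * c0.

Lemma rate_constant_gt0 : 0 < rate_constant.
Proof. by rewrite mulr_gt0 ?c0_gt0 // divr_gt0 // ln2_gt0. Qed.

Lemma half_sub_bounds (L l : nat) : (l <= L)%N ->
  (2 * (L - l)./2 + l <= L)%N /\ (L <= 2 * (L - l)./2 + l + 1)%N.
Proof. by move=> lL; have := odd_double_half (L - l); lia. Qed.

Lemma degree_choice : exists N, forall n, (N <= n)%N -> exists L d : nat,
  [/\ 2 * L%:R <= gap * (expansion_size n)%:R, (2 * d + k <= L)%N,
      (0 < expansion_size n)%N &
      rate_constant * degree_rate t Delta n <= (2 * d)%:R].
Proof.
have Dq0 : 0 < powR D q by apply: powR_gt0; exact: D_gt0.
pose a := ln 2 / 16 * c0 / (powR D q * ln D).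
have a0 : 0 < a by rewrite divr_gt0 ?rate_constant_gt0 // mulr_gt0 // lnD_gt0.
(* Beyond this threshold [n * a] exceeds everything lost in the truncations, the halving and the
   subtraction of [k]. *)
have [N hN] := eventually_ge ((gap + k%:R + 4) / a); exists N => n nN.
have := hN n nN; rewrite ler_pdivrMr // => hn.
have rateE : rate_constant * degree_rate t Delta n = n%:R * a.
  by rewrite /degree_rate -/D -/q /rate_constant /a; ring.
set M := expansion_size n.
have Mgt : c0 * n%:R / powR D q - 1 <= M%:R.
  by have := truncnS_gt (c0 * n%:R / powR D q); rewrite -/(expansion_size n) -/M -natr1; lra.
have gM : 2 * (n%:R * a) <= gap * M%:R / 2 + gap / 2.
  have -> : 2 * (n%:R * a) = gap * (c0 * n%:R / powR D q) / 2.
    by rewrite /a /gap; field; rewrite !gt_eqF ?lnD_gt0.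
  by have := ler_wpM2l (ltW gap_gt0) Mgt; lra.
pose L := Num.truncn (gap * M%:R / 2).
have gM0 : 0 <= gap * M%:R / 2 by rewrite divr_ge0 // mulr_ge0 // ltW // gap_gt0.
have Lle : L%:R <= gap * M%:R / 2 by rewrite truncn_le.
have Lgt : gap * M%:R / 2 - 1 <= L%:R.
  by have := truncnS_gt (gap * M%:R / 2); rewrite -/L -natr1; lra.
have g0 := gap_gt0.
have kL : (k + 3 <= L)%N by rewrite -(ler_nat R) natrD; lra.
have [d1 d2] := half_sub_bounds (leq_trans (leq_addr 3 k) kL).
exists L, ((L - k)./2)%N; split=> //.
- by lra.
- rewrite lt0n; apply: contraTneq kL => M0.
  by rewrite /L M0 mulr0 mul0r truncn0 addn3.
- by move: d2; rewrite rateE -(ler_nat R) !natrD; lra.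
Qed.

End Density.

Lemma prob_complement (n k m : nat) (A : instance n k m -> Prop) (E1 E2 E3 : {set instance n k m}) :
  (k <= n)%N ->
  (forall I, I \notin E1 -> I \notin E2 -> I \notin E3 -> A I) ->
  1 - (pr R E1 + pr R E2 + pr R E3) <= prob R A.
Proof.
move=> kn h; have T0 : 0 < #|{: instance n k m}|%:R :> R by rewrite ltr0n instance_gt0.
rewrite lerBlDr /prob /pr -!mulrDl ler_pdivlMr // mul1r -!natrD ler_nat.
pose X := [set I : instance n k m | `[< A I >]].
have -> : #|[pred x | `[< A x >]]| = #|X| by apply: eq_card => I; rewrite !inE.
have : (#|[set: instance n k m]| <= #|X :|: (E1 :|: E2 :|: E3)|)%N.
  apply: subset_leq_card; apply/subsetP => I _; rewrite in_setU orbC.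
  case: (boolP (I \in E1 :|: E2 :|: E3)) => //= nI; rewrite inE; apply/asboolP.
  by move: nI; rewrite !in_setU !negb_or => /andP[/andP[h1 h2] h3]; apply: h.
rewrite cardsT => /leq_trans; apply; apply: leq_trans (leq_card_setU _ _).1 _.
rewrite leq_add2l; apply: leq_trans (leq_card_setU _ _).1 _.
by rewrite leq_add2r (leq_card_setU _ _).1.
Qed.

Lemma prob_mono (T : finType) (A A' : T -> Prop) :
  (forall x, A x -> A' x) -> prob R A <= prob R A'.
Proof.
move=> h; rewrite /prob ler_wpM2r ?invr_ge0 // ler_nat subset_leq_card //.
by apply/subsetP => x; rewrite !inE => /asboolP hx; apply/asboolP/h.
Qed.

(** Three bad events have probability at most [eps / 3] each: failing expansion, at least [s]
    clashes, and too few isolated variables. Outside them the construction is deterministic. No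
    threshold involves [B], so [N] serves all weights at once. *)
Lemma hamming_weight_whp (k t : nat) (k0 : (0 < k)%N) (t3 : (3 <= t)%N)
    (P : {ffun 'I_k -> bool} -> bool) (nu : {ffun 'I_k -> bool} -> R) (Delta K eps : R) :
  is_distribution nu -> wise_uniform (t - 1) nu -> \sum_x nu x * (P x)%:R = 1 ->
  0 < Delta -> 0 < K -> 0 < eps ->
  exists N : nat, forall n : nat, (N <= n)%N ->
  forall B : int, `|B%:~R - n%:R / 2| <= K * Num.sqrt (n%:R : R) ->
    1 - eps <= prob R (fun I : instance n k (Num.truncn (Delta * n%:R)) =>
      exists (d : nat) (Et : {mpoly R[n]} -> R),
        [/\ rate_constant k * degree_rate t Delta n <= d%:R,
            is_pseudoexpectation d Et,
            satisfies_instance P I d Et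
          & satisfies_pseudovar0 Et (hamming_weight R n) B%:~R]).
Proof.
move=> nuD nuU nuP Delta0 K0 eps0.
have e3 : 0 < eps / 3 by rewrite divr_gt0.
have k1 : 1 <= k%:R :> R by rewrite ler1n.
have [N1 hN1] := degree_choice k0 t3 Delta0.
have [N2 hN2] := nonexpanding_series k0 t3 Delta0 e3.
have [s hs] := eventually_ge (2 * Delta * k%:R ^+ 2 / (eps / 3)).
have {hs} [s0 hs] : (0 < s.+1)%N /\ 2 * Delta * k%:R ^+ 2 / (eps / 3) <= s.+1%:R.
  by split => //; apply: hs.
move: (s.+1) s0 hs => {}s s0 hs.
pose rho : R := expR (- (8 * k%:R * Delta)).
have rho0 : 0 < rho by apply: expR_gt0.
have [N3 hN3] := eventually_ge (16 / rho / (eps / 3)).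
(* [N4] gives [2 K sqrt n <= n rho / 16] and [N5] gives [1 + k s <= n rho / 16]; together they fit
   into [n rho / 8] isolated variables. *)
have [N4 hN4] := eventually_ge ((32 * K / rho) ^+ 2).
have [N5 hN5] := eventually_ge (16 * (1 + k%:R * s%:R) / rho).
exists (N1 + N2 + N3 + N4 + N5 + 8 * k)%N => n nN B hB.
have [l1 l2 l3 [l4 l5 k8]] : [/\ (N1 <= n)%N, (N2 <= n)%N, (N3 <= n)%N &
    [/\ (N4 <= n)%N, (N5 <= n)%N & (8 * k <= n)%N]].
  by move: nN; clear => nN; split; last split; lia.
have [n2 kn] : (2 <= n)%N /\ (k <= n)%N by move: k0 k8; clear; lia.
have n0 : 0 < n%:R :> R by rewrite ltr0n ltnW.
have {}hN2 := hN2 n l2; have {}hN3 := hN3 n l3.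
have {}hN4 := hN4 n l4; have {}hN5 := hN5 n l5.
have [L [d [leLM dkL M0 rate]]] := hN1 n l1.
set m := Num.truncn _.
have mD : m%:R <= Delta * n%:R by rewrite /m truncn_le mulr_ge0 // ltW.
set M := expansion_size k t Delta n in leLM M0 hN2.
pose E1 := nonexpanding n k m t (gap Delta) M.
pose E2 := [set I : instance n k m | (s <= #|clashes I|)%N].
pose E3 := [set I : instance n k m | #|isolated I|%:R < n%:R * rho / 8].
have p1 : pr R E1 <= eps / 3.
  apply: le_trans hN2.
  have kM : (k * M <= n)%N by apply: k_expansion_size_le.
  exact: (pr_nonexpanding kn t3 k0 (gap_le Delta) Delta0 mD kM).
have p2 : pr R E2 <= eps / 3.
  apply: le_trans (pr_clashes R m kn k0 s0) _.
  have s0' : 0 < s%:R :> R by rewrite ltr0n.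
  have nk : n%:R <= 2 * (n - k).+1%:R :> R by rewrite -natrM ler_nat; move: k8; clear; lia.
  have nk0 : 0 < (n - k).+1%:R :> R by rewrite ltr0n.
  rewrite ler_pdivrMr //; move: hs; rewrite ler_pdivrMr // => hs.
  rewrite [leRHS]mulrC; apply: le_trans hs; rewrite mulrA ler_pdivrMr //.
  have : m%:R <= Delta * (2 * (n - k).+1%:R).
    by apply: le_trans mD _; rewrite ler_pM2l.
  by move=> /(ler_wpM2r (sqr_ge0 k%:R)); lra.
have p3 : pr R E3 <= eps / 3.
  apply: le_trans (pr_isolated kn k0 rho0 _ n2) _; first exact: avoid_pow_ge.
  by move: hN3; rewrite !ler_pdivrMr ?mulr_gt0 //; lra.
apply: le_trans (prob_complement kn (E1 := E1) (E2 := E2) (E3 := E3) _); first by lra.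
move=> I nE1 nE2 nE3.
have expan (F : {set 'I_m}) : (#|F| <= M)%N -> (2 * k%:R + 2 * gap Delta) * #|F|%:R <=
    2 * #|\bigcup_(f in F) (cell @: scope_set I f)|%:R + t%:R * #|F|%:R.
  move=> cF; case: (posnP #|F|) => [F0|F0].
    by rewrite F0 !mulr0 addr0 mulr_ge0.
  move: nE1; rewrite in_set => /existsPn/(_ F); rewrite F0 cF /= /thin -leNgt; exact.
have weight : 2 * `|B%:~R - n%:R / 2| + #|lonely I|%:R <= #|isolated I|%:R :> R.
  move: nE3; rewrite in_set -leNgt; apply: le_trans.
  have cl : #|lonely I|%:R <= 1 + k%:R * s%:R :> R.
    rewrite -natrM nat1r ler_nat.
    apply: leq_trans (card_lonely I) _.
    move: nE2; rewrite in_set -ltnNge => /ltnW lt.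
    by rewrite add1n ltnS leq_mul2l lt orbT.
  have sq : Num.sqrt n%:R * Num.sqrt n%:R = n%:R :> R.
    by rewrite -expr2 sqr_sqrtr // ltW.
  have sq0 : 0 < Num.sqrt n%:R :> R by rewrite sqrtr_gt0.
  have sqK : 32 * K / rho <= Num.sqrt n%:R.
    rewrite -(@ler_pXn2r _ 2) ?nnegrE ?divr_ge0 ?mulr_ge0 ?sqrtr_ge0 ?(ltW K0) ?(ltW rho0) //.
    by rewrite [leRHS]expr2 sq.
  move: sqK hN5; rewrite !ler_pdivrMr // => sqK hN5.
  have : 32 * K * Num.sqrt n%:R <= n%:R * rho.
    by apply: le_trans (ler_wpM2r (ltW sq0) sqK) _; rewrite mulrAC sq.
  by move: hB cl hN5; lra.
have [Et [pe si pv]] := weighted_pseudoexpectation (ltnW (ltnW t3)) nuD nuU nuP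
  (gap_gt0 Delta) expan leLM dkL M0 weight.
by exists (2 * d)%N, Et.
Qed.

End Asymptotics.

Theorem theorem1 (R : realType) (k t : nat) (hk : (3 <= k)%N) (ht : (3 <= t)%N) :
  exists2 c : R, 0 < c &
  forall P : {ffun 'I_k -> bool} -> bool,
  (exists nu : {ffun 'I_k -> bool} -> R,
     [/\ is_distribution nu,
         wise_uniform (t - 1) nu
       & \sum_(x : {ffun 'I_k -> bool}) nu x * (P x)%:R = 1]) ->
  forall Delta : R, 0 < Delta ->
  let m := fun n : nat => Num.truncn (Delta * n%:R) in
  (forall eps : R, 0 < eps ->
     exists N : nat, forall n : nat, (N <= n)%N ->
       1 - eps <= prob R (fun I : instance n k (m n) =>
         exists (d : nat) (Et : {mpoly R[n]} -> R),
           [/\ c * degree_rate t Delta n <= d%:R,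
               is_pseudoexpectation d Et,
               satisfies_instance P I d Et
             & ~~ odd n ->
               satisfies_pseudovar0 Et (hamming_weight R n) (n%:R / 2)]))
  /\
  (forall K : R, 0 < K -> forall eps : R, 0 < eps ->
     exists N : nat, forall n : nat, (N <= n)%N ->
     forall B : int, `|B%:~R - n%:R / 2| <= K * Num.sqrt (n%:R : R) ->
       1 - eps <= prob R (fun I : instance n k (m n) =>
         exists (d : nat) (Et : {mpoly R[n]} -> R),
           [/\ c * degree_rate t Delta n <= d%:R,
               is_pseudoexpectation d Et,
               satisfies_instance P I d Et
             & satisfies_pseudovar0 Et (hamming_weight R n) B%:~R])).
Proof.
have k0 : (0 < k)%N by apply: leq_trans hk.
exists (rate_constant R k); first exact: rate_constant_gt0.
move=> P [nu [nuD nuU nuP]] Delta Delta0 m; split; last first.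
  by move=> K K0 eps eps0; apply: (hamming_weight_whp k0 ht nuD nuU nuP).
move=> eps eps0.
(* The weight used is [n./2]: it equals [n / 2] for even [n] and is within [2^-1] of it for odd [n],
   so [K = 1] covers both parities. *)
have [N hN] := hamming_weight_whp k0 ht nuD nuU nuP Delta0 ltr01 eps0.
exists N.+1 => n nN.
have n1 : 1 <= n%:R :> R by rewrite ler1n; lia.
have nE : n%:R = (odd n)%:R + 2 * (n./2)%:R :> R.
  by rewrite -natrM -natrD mul2n odd_double_half.
have hB : `|(n./2%:Z)%:~R - n%:R / 2| <= 1 * Num.sqrt (n%:R : R).
  apply: (@le_trans _ _ 1).
    rewrite -pmulrn nE ler_norml; apply/andP.
    by case: (odd n) => /=; rewrite ?mulr1n ?mulr0n; split; lra.
  by rewrite mul1r -[leLHS]sqrtr1 ler_sqrt.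
apply: le_trans (hN n (ltnW nN) _ hB) _; apply: prob_mono => I [d [Et [rate pe si pv]]].
exists d, Et; split=> // nodd; move: pv; rewrite -pmulrn.
by have -> : (n./2)%:R = n%:R / 2 :> R by rewrite nE (negPf nodd) /= mulr0n; lra.
Qed.
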